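(* Let $P\subseteq M_{\mathbb R}$ be a $d$-dimensional centrally symmetric simplicial reflexive polytope. If $d$ is even, then $|\mathcal V(P)|\le 3d$, with equality if and only if $P^*\cong(\mathcal Z_2)^{d/2}$ as lattice polytopes. If $d$ is odd, then $|\mathcal V(P)|\le 3d-1$, with equality if and only if $P^*\cong[-1,1]\times(\mathcal Z_2)^{(d-1)/2}$ as lattice polytopes.
   Context: Let $M\cong\mathbb Z^d$ be a lattice with dual lattice $N$. A reflexive polytope is a $d$-dimensional lattice polytope $P\subseteq M_{\mathbb R}$ (vertices in $M$) with $0\in\mathrm{int}\,P$ whose dual $P^*=\{y\in N_{\mathbb R}:\langle x,y\rangle\ge -1\ \forall x\in P\}$ is a lattice polytope. $\mathcal V(P)$ is the set of vertices. $P$ is simplicial if every facet is a simplex, and centrally symmetric if $P=-P$. An isomorphism of lattice polytopes is an isomorphism of the lattices whose real linear extension maps one polytope onto the other. $\mathcal Z_2:=\mathrm{conv}([0,1]^2\cup(-[0,1]^2))\subseteq\mathbb R^2$ with lattice $\mathbb Z^2$, and $[-1,1]\subseteq\mathbb R$ with lattice $\mathbb Z$; powers and products are Cartesian. *)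

(* Defs.v *)
From HB Require Import structures.
From mathcomp Require Import all_boot all_order all_algebra.
From mathcomp Require Import all_classical all_reals all_analysis.

Set Implicit Arguments.
Unset Strict Implicit.
Unset Printing Implicit Defensive.

Import Order.TTheory GRing.Theory Num.Theory.
Import numFieldNormedType.Exports.

Local Open Scope classical_set_scope.
Local Open Scope ring_scope.

(* The real span M_R of the lattice M is an arbitrary finite-dimensional real
   vector space V, in which M sits as a set of vectors; N_R is the dual space
   'Hom(V, R^o), with <x, y> given by evaluation y x. *)

Definition is_lattice (R : realType) (V : vectType R) (L : set V) : Prop :=
  exists2 b : (\dim {:V}).-tuple V, basis_of fullv b &
    L = [set v | exists z : 'I_(\dim {:V}) -> int,
                   v = \sum_(i < \dim {:V}) b`_i *~ z i].

Definition dual_lattice (R : realType) (V : vectType R) (L : set V) :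
    set 'Hom(V, R^o) :=
  [set f | forall x, L x -> (f x : R) \is a Num.int].

Definition conv_hull (R : realType) (V : lmodType R) (S : set V) : set V :=
  [set x | exists (n : nat) (p : 'I_n -> V) (t : 'I_n -> R),
    [/\ forall i, S (p i), forall i, 0 <= t i, \sum_i t i = 1
      & x = \sum_i t i *: p i]].

Definition is_polytope (R : realType) (V : lmodType R) (P : set V) : Prop :=
  exists s : seq V, P = conv_hull [set` s].

(* S has dimension k if its affine hull does, the latter being the smallest
   affine subspace x + U containing S; the empty set has no dimension. *)
Definition has_dim (R : realType) (V : vectType R) (S : set V) (k : nat) :
    Prop :=
  exists (x : V) (U : {vspace V}),
    [/\ S x, \dim U = k, forall y, S y -> y - x \in U
      & forall W : {vspace V}, (forall y, S y -> y - x \in W) -> (U <= W)%VS].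

Definition is_face (R : realType) (V : vectType R) (P F : set V) : Prop :=
  exists (f : 'Hom(V, R^o)) (c : R),
    (forall x, P x -> (f x : R) <= c) /\ F = [set x | P x /\ (f x : R) = c].

Definition is_facet (R : realType) (V : vectType R) (P F : set V) : Prop :=
  is_face P F /\ exists k, has_dim P k.+1 /\ has_dim F k.

Definition vertices (R : realType) (V : vectType R) (P : set V) : set V :=
  [set v | is_face P [set v]].

Definition is_lattice_polytope (R : realType) (V : vectType R)
    (L P : set V) : Prop :=
  is_polytope P /\ vertices P `<=` L.

(* The topology of V is that of its coordinate space 'rV_(\dim V); it does not
   depend on the chosen basis. *)
Definition in_interior (R : realType) (V : vectType R) (P : set V) (x : V) :
    Prop :=
  (passmx.rVof (vbasis {:V}) @` P)° (passmx.rVof (vbasis {:V}) x).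

Definition dual_polytope (R : realType) (V : vectType R) (P : set V) :
    set 'Hom(V, R^o) :=
  [set f | forall x, P x -> -1 <= (f x : R)].

Definition is_reflexive (R : realType) (V : vectType R) (L P : set V) : Prop :=
  [/\ is_lattice_polytope L P,
      has_dim P (\dim {:V}),
      in_interior P 0
    & is_lattice_polytope (dual_lattice L) (dual_polytope P)].

Definition is_simplex (R : realType) (V : vectType R) (S : set V) : Prop :=
  exists (x : V) (s : seq V),
    free [seq y - x | y <- s] /\ S = conv_hull [set` x :: s].

Definition is_simplicial (R : realType) (V : vectType R) (P : set V) : Prop :=
  forall F, is_facet P F -> is_simplex F.

Definition centrally_symmetric (R : realType) (V : lmodType R) (P : set V) :
    Prop :=
  P = -%R @` P.

(* (L, P) and (L', P') are lattices spanning V and V' with polytopes; f is the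
   real linear extension of its restriction L -> L'. *)
Definition lattice_iso (R : realType) (V V' : lmodType R)
    (L P : set V) (L' P' : set V') : Prop :=
  exists f : {linear V -> V'}, [/\ bijective f, f @` L = L' & f @` P = P'].

Definition set_power (T : Type) (k : nat) (A : set T) :
    set {ffun 'I_k -> T} :=
  [set x | forall i, A (x i)].
Arguments set_power {T} k A.

Definition int_lattice1 (R : realType) : set R^o :=
  [set x | (x : R) \is a Num.int].
Arguments int_lattice1 R : clear implicits.

Definition segment1 (R : realType) : set R^o :=
  [set x | -1 <= (x : R) <= 1].
Arguments segment1 R : clear implicits.

Definition int_lattice2 (R : realType) : set 'rV[R]_2 :=
  [set x | forall i, x 0 i \is a Num.int].
Arguments int_lattice2 R : clear implicits.

Definition unit_square (R : realType) : set 'rV[R]_2 :=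
  [set x | forall i, 0 <= x 0 i <= 1].
Arguments unit_square R : clear implicits.

Definition Z2 (R : realType) : set 'rV[R]_2 :=
  conv_hull (unit_square R `|` -%R @` unit_square R).
Arguments Z2 R : clear implicits.

(* Main.v *)
From HB Require Import structures.
Require Import Defs.
From mathcomp Require Import all_boot all_order all_algebra.
From mathcomp Require Import all_classical all_reals all_analysis.
From mathcomp Require Import zify ring lra.
Set Implicit Arguments.
Unset Strict Implicit.
Unset Printing Implicit Defensive.
Import Order.TTheory GRing.Theory Num.Theory.
Local Open Scope classical_set_scope.
Local Open Scope card_scope.
Local Open Scope ring_scope.

(** The argument works in the basis given by one facet. Since
    [dual_polytope P] is a polytope it has a vertex [u]; the points of [P]
    where [u = -1] form a facet, hence a simplex, whose vertices
    [e_1, ..., e_d] are a basis of [V]. All vertices of [P] are lattice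
    points, [u] is integral and [P = -P], so [u] takes on them only the
    values [-1], [0] and [1]. Level [-1] consists of the [e_i] and level [1]
    of the [- e_i]; everything depends on level [0], the equator.

    Moving [u] along the dual basis vector [e_i^*] until a new point of [P]
    becomes tight gives the neighbouring facet opposite to [e_i]
    ([facet_neighbour]). Both facets are simplices sharing all the [e_j],
    [j != i], so the neighbour contains exactly one further vertex. By
    integrality an equator vertex whose [i]-th coordinate is negative lies on
    the neighbour; so there is at most one such vertex, its [i]-th coordinate
    is [-1], and [e_i^*] is the difference of two vertices of the dual
    polytope, hence integral ([level_zero_coord]). Consequently the sets of
    negative coordinates of equator vertices are disjoint and nonempty, which
    bounds the equator by [d]. They are singletons if the equator has at
    least [d - 1] members, since [v] and [- v] have equally many negative
    coordinates: the equator then consists of differences [e_j - e_i] along a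
    matching of the indices ([equator_bound]). A matching covers an even
    number of indices, whence the loss of one vertex for odd [d].

    In the extremal case [P] is the convex hull of the [e_i], the [- e_i] and
    the matched differences, and the [e_i^*] are a basis of the dual lattice,
    so in the coordinates [f |-> f e_i] the dual polytope is cut out by
    [-1 <= x_i <= 1] and [x_i - x_j <= 1] for matched [i], [j]: a product of
    hexagons, and of one segment if [d] is odd. Such [hex_coordinates] exist
    for the model polytopes too, and two polytopes with hex coordinates of
    the same shape are isomorphic.

    Conversely, suppose that the dual polytope has hex coordinates. It is
    also cut out by the inequalities [-1 <= f v] for the vertices [v] of [P],
    and every irredundant inequality of one system occurs in any other
    ([facet_functionals_bound]). So [P] has at least as many vertices as the
    product of hexagons has facets, and that number is the upper bound. *)

(** * Functionals, convex hulls and vertices *)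

(** Finitely many positive slacks [b x] leave room for a small perturbation
    along [c]. *)
Lemma small_scale (R : realType) (T : eqType) (s : seq T) (b c : T -> R) :
  (forall x, x \in s -> 0 < b x) ->
  exists2 eps : R, 0 < eps & forall x, x \in s -> eps * `|c x| < b x.
Proof.
elim: s => [|a s IH] bpos; first by exists 1.
have [|eps eps0 epsP] := IH.
  by move=> x xs; apply: bpos; rewrite inE xs orbT.
have ba : 0 < b a by apply: bpos; rewrite mem_head.
pose eta := b a / (`|c a| + 1).
have ca : 0 < `|c a| + 1 by rewrite ltr_wpDl.
have eta0 : 0 < eta by rewrite divr_gt0.
exists (Num.min eps eta); first by rewrite lt_min eps0.
move=> x; rewrite inE => /predU1P[->|xs].
  apply: (@le_lt_trans _ _ (eta * `|c a|)).
    by rewrite ler_wpM2r// ge_min lexx orbT.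
  rewrite /eta -mulrA gtr_pMr// mulrC ltr_pdivrMr// mul1r.
  by rewrite ltrDl.
apply: le_lt_trans (epsP x xs).
by rewrite ler_wpM2r// ge_min lexx.
Qed.

Lemma seq_argmax (R : realType) (T : eqType) (s : seq T) (f : T -> R) :
  s != [::] -> exists2 v, v \in s & forall p, p \in s -> f p <= f v.
Proof.
case: s => // a s _; elim: s a => [|c s IH] a.
  by exists a => [|p]; rewrite inE// => /eqP->.
have [v vs vmax] := IH c.
have [av|va] := leP (f a) (f v).
  exists v => [|p]; first by rewrite inE vs orbT.
  by rewrite inE => /predU1P[->//|]; exact: vmax.
exists a => [|p]; first by rewrite mem_head.
by rewrite inE => /predU1P[->//|/vmax/le_trans]; apply; exact: ltW.
Qed.

Lemma functionalZ (R : realType) (W : vectType R) (f : 'Hom(W, R^o))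
    (a : R) (x : W) : f (a *: x) = a * (f x : R) :> R.
Proof. by rewrite linearZ. Qed.

(** Functionals are obtained from formulas through this lemma, which avoids
    building structure instances by hand. *)
Lemma functional_exists (R : realType) (W : vectType R) (f : W -> R) :
  (forall a x y, f (a *: x + y) = a * f x + f y) ->
  exists g : 'Hom(W, R^o), forall x, g x = f x :> R.
Proof.
move=> flin; have f_linear : linear (f : W -> R^o) by [].
pose fL : {linear W -> R^o} :=
  HB.pack (f : W -> R^o) (GRing.isLinear.Build _ _ _ _ (f : W -> R^o) f_linear).
by exists (linfun fL) => x; rewrite lfunE.
Qed.

Lemma functional_combination (R : realType) (W : vectType R)
    (f : 'Hom(W, R^o)) n (p : 'I_n -> W) (t : 'I_n -> R) :
  f (\sum_i t i *: p i) = \sum_i t i * (f (p i) : R) :> R.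
Proof.
by rewrite linear_sum/=; apply: eq_bigr => i _; rewrite functionalZ.
Qed.

Lemma conv_hull_le (R : realType) (W : vectType R) (S : set W)
    (f : 'Hom(W, R^o)) (c : R) (x : W) :
  (forall y, S y -> (f y : R) <= c) -> conv_hull S x -> (f x : R) <= c.
Proof.
move=> fS [n [p [t [Sp t0 t1 ->]]]].
rewrite functional_combination -[leRHS]mul1r -t1 mulr_suml.
by apply: ler_sum => i _; rewrite ler_wpM2l// fS.
Qed.

Lemma conv_hull_ge (R : realType) (W : vectType R) (S : set W)
    (f : 'Hom(W, R^o)) (c : R) (x : W) :
  (forall y, S y -> c <= (f y : R)) -> conv_hull S x -> c <= (f x : R).
Proof.
move=> fS [n [p [t [Sp t0 t1 ->]]]].
rewrite functional_combination -[leLHS]mul1r -t1 mulr_suml.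
by apply: ler_sum => i _; rewrite ler_wpM2l// fS.
Qed.

Lemma conv_hull_sub (R : realType) (W : vectType R) (S : set W) :
  S `<=` conv_hull S.
Proof.
move=> x Sx; exists 1%N, (fun=> x), (fun=> 1).
by split=> //; rewrite big_ord1 ?scale1r.
Qed.

(** A convex combination attains the maximum of a functional only if all
    points of positive weight do. *)
Lemma conv_hull_extreme (R : realType) (W : vectType R) (S : set W)
    (f : 'Hom(W, R^o)) (v x : W) :
  (forall y, S y -> (f y : R) <= f v) ->
  (forall y, S y -> (f y : R) = f v -> y = v) ->
  conv_hull S x -> (f x : R) = f v -> S v /\ x = v.
Proof.
move=> fS fv [n [p [t [Sp t0 t1 ->]]]].
rewrite functional_combination => /esym fE.
have gap0 i : t i * ((f v : R) - f (p i)) = 0.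
  have: \sum_i t i * ((f v : R) - f (p i)) = 0.
    under eq_bigr do rewrite mulrBr.
    by rewrite sumrB -mulr_suml t1 mul1r [X in X - _]fE subrr.
  move=> /eqP; rewrite psumr_eq0 => [/allP/(_ i)|j _].
    by rewrite mem_index_enum => /(_ isT)/eqP.
  by rewrite mulr_ge0// subr_ge0 fS.
have pv i : t i != 0 -> p i = v.
  move=> ti; apply: fv => //; apply/esym/eqP; rewrite -subr_eq0.
  by have /eqP := gap0 i; rewrite mulf_eq0 (negbTE ti).
split.
  have [i ti] : exists i, t i != 0.
    apply: contrapT => no; move: t1; rewrite big1 => [/esym/eqP|i _].
      by rewrite oner_eq0.
    by apply/eqP/negP => /negP ti; apply: no; exists i.
  by rewrite -(pv i ti).
transitivity (\sum_i t i *: v); last by rewrite -scaler_suml t1 scale1r.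
apply: eq_bigr => i _; have [->|/pv->//] := eqVneq (t i) 0.
by rewrite !scale0r.
Qed.

Lemma vertex_in_generators (R : realType) (V : vectType R) (P S : set V)
    (v : V) :
  vertices P v -> S `<=` P -> conv_hull S v -> S v.
Proof.
move=> [f [c [fP vE]]] SP Sv.
have [Pv fv] : P v /\ (f v : R) = c.
  by have: [set v] v by []; rewrite vE.
have [||//|//] := @conv_hull_extreme _ _ S f v v _ _ Sv.
- by move=> y Sy; rewrite fv; apply/fP/SP.
move=> y Sy fy; have: [set v] y; last by [].
by rewrite vE; split; [exact: SP|rewrite fy].
Qed.

Lemma vertex_in (R : realType) (V : vectType R) (P : set V) (v : V) :
  vertices P v -> P v.
Proof. by move=> [f [c [_ vE]]]; have: [set v] v by []; rewrite vE => -[]. Qed.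

(** For small [eps > 0] the functional [f + eps *: g] is maximal at [v] only:
    [f] separates [v] from the points with a smaller value, [g] breaks the
    ties. *)
Lemma lexicographic_vertex (R : realType) (V : vectType R) (s : seq V)
    (f g : 'Hom(V, R^o)) (v : V) :
  conv_hull [set` s] v ->
  (forall p, p \in s -> (f p : R) <= f v) ->
  (forall p, p \in s -> (f p : R) = f v -> p != v -> (g p : R) < g v) ->
  vertices (conv_hull [set` s]) v.
Proof.
move=> sv fmax gmax.
have [|eps eps0 epsP] := @small_scale R _ [seq p <- s | (f p : R) < f v]
  (fun p => (f v : R) - f p) (fun p => (g p : R) - g v).
  by move=> p; rewrite mem_filter subr_gt0 => /andP[].
pose h : 'Hom(V, R^o) := f + eps *: g.
have hE x : h x = (f x : R) + eps * (g x : R) :> R.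
  by rewrite /h add_lfunE scale_lfunE.
have hlt p : p \in s -> p != v -> (h p : R) < h v.
  move=> ps pv; rewrite !hE.
  have [fpv|fpv] := eqVneq (f p : R) (f v).
    by rewrite fpv ltrD2l ltr_pM2l// gmax.
  have flt : (f p : R) < f v by rewrite lt_neqAle fpv fmax.
  have := epsP p; rewrite mem_filter flt ps => /(_ isT).
  have : eps * ((g p : R) - g v) <= eps * `|(g p : R) - g v|.
    by rewrite ler_wpM2l ?ler_norm// ltW.
  move: (f p : R) (f v : R) (g p : R) (g v : R) => fp fv gp gv; lra.
have hle p : p \in s -> (h p : R) <= h v.
  by move=> ps; have [->//|/(hlt _ ps)/ltW] := eqVneq p v.
exists h, (h v); split; first by move=> x; apply: conv_hull_le hle.
apply/seteqP; split=> [x ->//|x [sx hx]] /=.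
have [//||//|//|_ ->//] := @conv_hull_extreme _ _ [set` s] h v x.
by move=> y ys hy; apply/eqP/negP => /negP/(hlt _ ys); rewrite hy ltxx.
Qed.

(** A point [v] farthest from the origin for a Euclidean norm is the unique
    maximiser of the inner product with [v], since
    [2 <v, p> = |p|^2 + |v|^2 - |p - v|^2]. *)
Lemma farthest_point (R : realType) (V : vectType R) (s : seq V) :
  s != [::] ->
  exists2 v, v \in s &
    exists g : 'Hom(V, R^o), forall p, p \in s -> p != v -> (g p : R) < g v.
Proof.
case: s => // a s _.
pose b := vbasis {:V}.
pose nrm2 (x : V) : R := \sum_i coord b i x ^+ 2.
have [v vs vmax] := @seq_argmax _ _ (a :: s) nrm2 isT.
exists v => //.
have [g gE] : exists g : 'Hom(V, R^o),
    forall x, g x = \sum_i coord b i v * coord b i x :> R.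
  apply: functional_exists => k x y.
  rewrite mulr_sumr -big_split/=; apply: eq_bigr => i _.
  by rewrite linearP/= mulrDr mulrCA.
exists g => p ps pv; rewrite !gE.
have : 0 < nrm2 (p - v).
  rewrite lt_def sumr_ge0 ?andbT => [|i _]; last exact: sqr_ge0.
  apply: contra pv; rewrite psumr_eq0 => [/allP c0|i _]; last exact: sqr_ge0.
  rewrite -subr_eq0; apply/eqP.
  rewrite (coord_vbasis (memvf (p - v))) big1// => i _.
  move: (c0 i); rewrite mem_index_enum sqrf_eq0 => /(_ isT)/eqP->.
  by rewrite scale0r.
have -> : nrm2 (p - v) =
    nrm2 p + nrm2 v - (\sum_i coord b i v * coord b i p) *+ 2.
  rewrite /nrm2 -big_split/= -sumrMnl -sumrB; apply: eq_bigr => i _.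
  by rewrite linearB/=; ring.
have -> : \sum_i coord b i v * coord b i v = nrm2 v.
  by apply: eq_bigr => i _; rewrite expr2.
have := vmax p ps; lra.
Qed.

(** Ties among the maximisers of [f] are broken by [farthest_point]. This
    gives both the existence of vertices and, applied to [- f], the fact that
    an inequality on a polytope need only be checked at its vertices. *)
Lemma vertex_maximizing (R : realType) (V : vectType R) (s : seq V)
    (f : 'Hom(V, R^o)) :
  s != [::] ->
  exists2 v, vertices (conv_hull [set` s]) v &
    forall x, conv_hull [set` s] x -> (f x : R) <= f v.
Proof.
move: s => S sn0.
have [w wS wmax] := @seq_argmax R _ S (fun x => f x : R) sn0.
have [|v] := @farthest_point R V [seq p <- S | (f p : R) == f w].
  have : w \in [seq p <- S | (f p : R) == f w] by rewrite mem_filter eqxx.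
  by apply: contraTneq => ->.
rewrite mem_filter => /andP[/eqP fv vS] [g gmax].
exists v => [|x]; last by rewrite fv; apply: conv_hull_le.
apply: (@lexicographic_vertex _ _ _ f g) => [|p pS|p pS fp].
- exact: conv_hull_sub.
- by rewrite fv wmax.
- by apply: gmax; rewrite mem_filter pS fp fv eqxx.
Qed.

(** * Vertices of the dual polytope and facets *)

Lemma functional_separating (R : realType) (V : vectType R) (U : {vspace V})
    (v : V) :
  v \notin U ->
  exists w : 'Hom(V, R^o), (forall x, x \in U -> w x = 0) /\ w v != 0.
Proof.
move=> vU; have qv : v - projv U v != 0.
  by apply: contra vU; rewrite subr_eq0 => /eqP->; rewrite memv_proj.
have [i ci] : exists i, coord (vbasis {:V}) i (v - projv U v) != 0.
  apply: contrapT => no; move/eqP: qv; apply.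
  rewrite (coord_vbasis (memvf (v - projv U v))) big1// => i _.
  have [->|ci] := eqVneq (coord (vbasis {:V}) i (v - projv U v)) 0.
    by rewrite scale0r.
  by case: no; exists i.
have [w wE] : exists w : 'Hom(V, R^o), forall x,
    w x = coord (vbasis {:V}) i (x - projv U x) :> R.
  apply: functional_exists => a x y.
  by rewrite linearP/= opprD addrACA -scalerBr linearP.
exists w; split=> [x xU|]; last by rewrite wE.
by apply: etrans (wE x) _; rewrite projv_id// subrr linear0.
Qed.

Lemma dim_hyperplane (R : realType) (V : vectType R) (f : 'Hom(V, R^o))
    (x : V) :
  f x != 0 -> \dim (lker f) = (\dim {:V}).-1.
Proof.
move=> fx; have := limg_ker_dim f fullv; rewrite capfv => <-.
have -> : \dim (limg f) = 1%N; last by rewrite addn1.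
apply/eqP; rewrite eqn_leq; apply/andP; split.
  by have := dimvS (subvf (limg f)); rewrite dimvf.
rewrite lt0n dimv_eq0; apply: contra fx => /eqP f0.
by have := memv_img f (memvf x); rewrite f0 memv0.
Qed.

Section DualVertex.
Context (R : realType) (V : vectType R) (P : set V) (s : seq V).
Hypothesis PE : P = conv_hull [set` s].

Lemma dual_polytopeP (f : 'Hom(V, R^o)) :
  (forall p, p \in s -> -1 <= (f p : R)) -> dual_polytope P f.
Proof. by move=> fs x; rewrite PE; apply: conv_hull_ge. Qed.

Lemma generator_mem p : p \in s -> P p.
Proof. by move=> ps; rewrite PE; apply: conv_hull_sub. Qed.

(** A functional [w] vanishing on all points tight for [u] could be added to
    and subtracted from [u] in small multiples without leaving the dual
    polytope, so [u] would not be a vertex. *)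
Lemma dual_vertex_span (u : 'Hom(V, R^o)) :
  vertices (dual_polytope P) u ->
  (<<[seq p <- s | (u p : R) == -1%R]>> = fullv)%VS.
Proof.
move=> uv; apply/eqP; rewrite eqEsubv subvf/=; apply/subvP => v _.
apply: contrapT => /negP /functional_separating [w [w0 wv]].
have Pu := vertex_in uv.
case: uv => h [c [hle hE]].
have hu : (h u : R) = c by have: [set u] u by []; rewrite hE => -[].
have [|eps eps0 epsP] := @small_scale R _ [seq p <- s | (u p : R) != -1%R]
    (fun p => (u p : R) + 1) (fun p => w p : R).
  move=> p; rewrite mem_filter => /andP[up /generator_mem/Pu].
  by rewrite le_eqVlt eq_sym (negbTE up)/= -subr_gt0 opprK.
have dual_pm (a : R) : `|a| = eps -> dual_polytope P (u + a *: w).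
  move=> aeps; apply: dual_polytopeP => p ps.
  rewrite add_lfunE scale_lfunE.
  have [up|up] := eqVneq (u p : R) (-1).
    rewrite w0 ?scaler0 ?addr0 ?up//.
    by apply: memv_span; rewrite mem_filter ps up eqxx.
  have := epsP p; rewrite mem_filter ps up => /(_ isT).
  rewrite -aeps -normrM => /ltW; rewrite ler_norml => /andP[+ _].
  rewrite /GRing.scale/=.
  by move: (u p : R) (a * (w p : R)) => x y; lra.
have hE' (a : R) : h (u + a *: w) = c + a * (h w : R) :> R.
  by rewrite linearD/= functionalZ hu.
have hw : (h w : R) = 0.
  have := hle _ (dual_pm eps (gtr0_norm eps0)).
  have := hle _ (dual_pm (- eps) _); rewrite normrN gtr0_norm// => /(_ erefl).
  rewrite !hE'; move: (h w : R) eps0 => y; nra.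
have : [set u] (u + eps *: w).
  by rewrite hE; split; [apply/dual_pm/gtr0_norm|rewrite hE' hw mulr0 addr0].
move=> /= /(congr1 (fun f : 'Hom(V, R^o) => f v)).
rewrite add_lfunE scale_lfunE => /eqP.
rewrite -subr_eq0 addrAC subrr add0r scaler_eq0 (negbTE wv) orbF.
by rewrite gt_eqF.
Qed.

Variable d : nat.
Hypotheses (dimV : \dim {:V} = d) (d_gt0 : (0 < d)%N).
Hypotheses (dimP : has_dim P d) (simpP : is_simplicial P).

(** The tight points span [V], so their differences span the hyperplane
    [lker u]. *)
Lemma dual_vertex_facet (u : 'Hom(V, R^o)) :
  vertices (dual_polytope P) u -> is_facet P [set x | P x /\ (u x : R) = -1].
Proof.
move=> uv; have spanX := dual_vertex_span uv.
have Pu := vertex_in uv.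
set X := [seq _ <- _ | _] in spanX.
split.
  exists (- u), 1; split=> [x Px|].
    by rewrite opp_lfunE lerNl; exact: Pu.
  apply/seteqP; split=> x [Px ux]; split=> //.
    by rewrite opp_lfunE ux opprK.
  by move: ux; rewrite opp_lfunE => <-; rewrite opprK.
exists d.-1; rewrite prednK//; split=> //.
have [x xX] : exists x, x \in X.
  move: spanX; case: (X) => [|x X' _]; last by exists x; rewrite mem_head.
  by rewrite span_nil => fv; move: d_gt0; rewrite -dimV -fv dimv0.
have XF y : y \in X -> P y /\ (u y : R) = -1.
  by rewrite mem_filter => /andP[/eqP uy /generator_mem].
have ux := (XF _ xX).2.
exists x, (lker u); split.
- exact: XF.
- by rewrite (@dim_hyperplane _ _ _ x) ?dimV// ux oppr_eq0 oner_eq0.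
- move=> y [_ uy]; rewrite memv_ker linearB/= uy [X in _ - X]ux subrr//.
- move=> W WP; apply/subvP => z; rewrite memv_ker => /eqP uz.
  have : z \in ((W :&: lker u) + <[x]>)%VS.
    suff -> : ((W :&: lker u) + <[x]> = fullv)%VS by exact: memvf.
    apply/eqP; rewrite eqEsubv subvf/= -spanX; apply/span_subvP => y yX.
    rewrite -[y](subrK x) memv_add ?memv_line// memv_cap.
    by rewrite WP; [rewrite memv_ker linearB/= (XF _ yX).2 ux subrr|exact: XF].
  move=> /memv_addP[w]; rewrite memv_cap memv_ker => /andP[wW /eqP uw].
  move=> [_ /vlineP[k ->]] zE; move: uz; rewrite zE linearD/= uw add0r.
  rewrite functionalZ ux => /eqP; rewrite mulrN1 oppr_eq0 => /eqP ->.
  by rewrite scale0r addr0.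
Qed.

(** Spanning forces at least [d] points, affine independence inside the
    hyperplane [u = -1] at most [d]. *)
Lemma dual_vertex_basis (u : 'Hom(V, R^o)) :
  vertices (dual_polytope P) u ->
  exists2 e : d.-tuple V, basis_of fullv e &
    [set x | P x /\ (u x : R) = -1] = conv_hull [set` e].
Proof.
move=> uv; have spanX := dual_vertex_span uv.
have [x [t [free_t FE]]] := simpP (dual_vertex_facet uv).
have uE y : y \in x :: t -> (u y : R) = -1.
  move=> yt; have : conv_hull [set` x :: t] y by exact: conv_hull_sub.
  by rewrite -FE => -[].
have spanE : (fullv <= <<x :: t>>)%VS.
  rewrite -spanX; apply/span_subvP => y; rewrite mem_filter.
  move=> /andP[/eqP uy /generator_mem Py].
  have : conv_hull [set` x :: t] y by rewrite -FE.
  move=> [n [p [c [pS _ _ ->]]]].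
  by apply: memv_suml => i _; rewrite memvZ// memv_span//; exact: pS.
have size_t : (size t <= d.-1)%N.
  rewrite -(size_map (fun y => y - x)) -(eqP free_t).
  have -> : d.-1 = \dim (lker u).
    have ux : u x != 0 by rewrite uE ?mem_head// oppr_eq0 oner_eq0.
    by rewrite (dim_hyperplane ux) dimV.
  apply/dimvS/span_subvP => _ /mapP[y yt ->].
  by rewrite memv_ker linearB/= !uE ?subrr ?mem_head// inE yt orbT.
have basis_xt : basis_of fullv (x :: t).
  by rewrite basisEdim spanE dimV -(prednK d_gt0) ltnS.
have size_xt : size (x :: t) == d.
  rewrite eqn_leq -{1}(prednK d_gt0) ltnS size_t -dimV.
  exact: leq_trans (dimvS spanE) (dim_span _).
by exists (Tuple size_xt).
Qed.
End DualVertex.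

Lemma functional_eq (R : realType) (V : vectType R) n (e : n.-tuple V)
    (f g : 'Hom(V, R^o)) :
  basis_of fullv e -> (forall i : 'I_n, f e`_i = g e`_i) -> f = g.
Proof.
move=> be fg; apply/lfunP => x.
rewrite (coord_basis be (memvf x)) !linear_sum; apply: eq_bigr => i _.
by rewrite !linearZ/= fg.
Qed.

Definition dual_vector (R : realType) (V : vectType R) n (e : n.-tuple V)
  (i : 'I_n) : 'Hom(V, R^o) := linfun (coord e i : V -> R^o).

Lemma dual_vectorE (R : realType) (V : vectType R) n (e : n.-tuple V) i x :
  dual_vector e i x = coord e i x :> R.
Proof. by rewrite /dual_vector lfunE. Qed.

Lemma conv_basis_coord (R : realType) (V : vectType R) n (e : n.-tuple V) x :
  free e -> conv_hull [set` e] x ->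
  (forall i, 0 <= coord e i x) /\ \sum_i coord e i x = 1.
Proof.
move=> free_e ex.
have eE (y : V) : y \in e -> exists i : 'I_n, y = e`_i.
  by move=> /tnthP[i ->]; exists i; rewrite (tnth_nth 0).
split=> [i|].
  rewrite -dual_vectorE; apply: conv_hull_ge ex => y /eE[j ->].
  by rewrite dual_vectorE coord_free// ler0n.
have [g gE] : exists g : 'Hom(V, R^o), forall x, g x = \sum_i coord e i x :> R.
  apply: functional_exists => a y z.
  by rewrite mulr_sumr -big_split; apply: eq_bigr => i _; rewrite linearP.
have g1 y : [set` e] y -> (g y : R) = 1.
  move=> /eE[j ->]; rewrite gE (bigD1 j)//= coord_free// eqxx big1 ?addr0//.
  by move=> i ij; rewrite coord_free// eq_sym (negbTE ij).
rewrite -gE; apply/le_anti/andP; split.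
  by apply: conv_hull_le ex => y /g1->.
by apply: conv_hull_ge ex => y /g1->.
Qed.

(** The sum of the points of [X] is a functional on the dual space whose
    minimum on the dual polytope forces the value [-1] on all of [X], hence
    on a spanning set. *)
Lemma dual_vertexP (R : realType) (V : vectType R) (P : set V) (X : seq V)
    (f : 'Hom(V, R^o)) :
  dual_polytope P f -> {in X, forall x, P x /\ (f x : R) = -1} ->
  (<<X>> = fullv)%VS -> vertices (dual_polytope P) f.
Proof.
move=> Pf XP spanX.
have [h hE] : exists h : 'Hom('Hom(V, R^o), R^o),
    forall g : 'Hom(V, R^o), h g = - \sum_(x <- X) (g x : R) :> R.
  apply: functional_exists => a g k.
  rewrite mulrN mulr_sumr -opprD -big_split/=; congr (- _).
  by apply: eq_bigr => x _; rewrite add_lfunE scale_lfunE.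
(* The functional [h] falls short of its bound by the total slack on [X]. *)
have hgap g : (size X)%:R - (h g : R) = \sum_(x <- X) ((g x : R) + 1).
  by rewrite hE opprK big_split/= -sum1_size natr_sum addrC.
exists h, (size X)%:R; split=> [g Pg|].
  rewrite -subr_ge0 hgap big_seq sumr_ge0// => x /XP[Px _].
  by rewrite -lerBlDr sub0r; exact: Pg.
apply/seteqP; split=> g /=.
  move=> ->; split=> //; apply/eqP; rewrite eq_sym -subr_eq0 hgap.
  by rewrite big_seq big1// => x /XP[_ ->]; rewrite addNr.
move=> [Pg /eqP]; rewrite eq_sym -subr_eq0 hgap big_seq psumr_eq0; last first.
  by move=> x /XP[Px _]; rewrite -lerBlDr sub0r; exact: Pg.
move=> /allP g1; apply/lfunP => y.
have /subvP/(_ y (memvf _)) : (fullv <= lker (g - f))%VS.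
  rewrite -spanX; apply/span_subvP => x xX; rewrite memv_ker.
  have := g1 x xX; rewrite xX => /= /eqP gx.
  rewrite add_lfunE opp_lfunE (XP x xX).2 opprK; exact/eqP.
by rewrite memv_ker add_lfunE opp_lfunE subr_eq0 => /eqP.
Qed.

Lemma tight_vertex_mem (R : realType) (V : vectType R) (P : set V) (X : seq V)
    (u : 'Hom(V, R^o)) (v : V) :
  [set x | P x /\ (u x : R) = -1] = conv_hull [set` X] ->
  vertices P v -> (u v : R) = -1 -> v \in X.
Proof.
move=> FX vv uv; have Pv := vertex_in vv.
apply: (vertex_in_generators (S := [set` X]) vv) => [x xX|].
  have : conv_hull [set` X] x by exact: conv_hull_sub.
  by rewrite -FX => -[].
by rewrite -FX.
Qed.

(** * Disjoint families and matchings of indices *)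

Lemma disjoint_family_bound (T : eqType) d (Z : seq T) (N : T -> {set 'I_d}) :
  uniq Z ->
  (forall v w i, v \in Z -> w \in Z -> i \in N v -> i \in N w -> v = w) ->
  (\sum_(v <- Z) #|N v| <= d)%N.
Proof.
move=> uZ disj.
under eq_bigr => v _ do rewrite -sum1_card big_mkcond.
rewrite exchange_big/= -[leqRHS](card_ord d) -sum1_card; apply: leq_sum => i _.
rewrite -big_mkcond sum1_count -size_filter.
case E: [seq _ <- _ | _] => [//|v [//|w t]].
have uF : uniq [seq x <- Z | i \in N x] by rewrite filter_uniq.
have vF : v \in [seq x <- Z | i \in N x] by rewrite E mem_head.
have wF : w \in [seq x <- Z | i \in N x] by rewrite E !inE eqxx orbT.
move: vF wF uF; rewrite !mem_filter E /= => /andP[iv vZ] /andP[iw wZ].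
by rewrite (disj v w i)// inE eqxx.
Qed.

(** If [N v] had two elements, so would the disjoint set [N (opp v)]: the
    family would then occupy at least [size Z + 2 > d] indices. *)
Lemma disjoint_family_tight (T : eqType) d (Z : seq T) (N : T -> {set 'I_d})
    (opp : T -> T) :
  uniq Z ->
  (forall v w i, v \in Z -> w \in Z -> i \in N v -> i \in N w -> v = w) ->
  (forall v, v \in Z -> (0 < #|N v|)%N) ->
  (forall v, v \in Z -> [/\ opp v \in Z, opp v != v & #|N (opp v)| = #|N v|]) ->
  (d <= (size Z).+1)%N -> forall v, v \in Z -> #|N v| = 1%N.
Proof.
move=> uZ disj N0 oppP dZ v vZ.
have := disjoint_family_bound uZ disj.
have [oZ ov oN] := oppP v vZ.
have ow : opp v \in rem v Z by rewrite mem_rem_uniq// inE ov.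
rewrite (big_rem v)//= (big_rem (opp v))//= oN.
have : (size (rem (opp v) (rem v Z)) <=
        \sum_(y <- rem (opp v) (rem v Z)) #|N y|)%N.
  rewrite -sum1_size big_seq [leqRHS]big_seq; apply: leq_sum => y.
  by move=> /mem_rem/mem_rem/N0.
rewrite !size_rem//; have := N0 v vZ.
have : (0 < size Z)%N by case: (Z) vZ.
have : (0 < (size Z).-1)%N by rewrite -(size_rem vZ); case: (rem v Z) ow.
move: (size Z) dZ #|N v| (\sum_(y <- _) _)%N => a da b c; lia.
Qed.

(** A symmetric relation with at most one partner for each index is a
    matching; its edges are enumerated by their smaller ends, which shows in
    particular that the number of matched indices is even. *)
Lemma matching_enum d (E : rel 'I_d) :
  symmetric E -> irreflexive E -> (forall i j k, E i j -> E i k -> j = k) ->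
  exists k c (h : 'I_k * bool + 'I_c -> 'I_d),
    [/\ bijective h,
        forall i j, E i j <->
          exists x b, i = h (inl (x, b)) /\ j = h (inl (x, ~~ b)),
        #|[set i | [exists j, E i j]]%SET| = k.*2 & d = (k.*2 + c)%N].
Proof.
move=> Esym Eirr Efun.
pose I := [set i | [exists j, E i j]]%SET.
pose H := [set i : 'I_d | [exists j : 'I_d, (i < j)%N && E i j]]%SET.
pose m i := odflt i [pick j | E i j].
have mP i j : E i j -> m i = j.
  rewrite /m; case: pickP => [k Eik|/(_ j)->//] Eij.
  exact: Efun Eik Eij.
have HP i : i \in H -> (i < m i)%N /\ E i (m i).
  by rewrite inE => /existsP[j /andP[ij Eij]]; rewrite (mP i j).
pose h (x : 'I_#|H| * bool + 'I_#|~: I|) : 'I_d :=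
  match x with
  | inl (y, b) => if b then m (enum_val y) else enum_val y
  | inr y => enum_val y
  end.
have hE y b : E (h (inl (y, b))) (h (inl (y, ~~ b))).
  have [_ Ey] := HP _ (enum_valP y).
  by case: b => //=; rewrite Esym.
have hI y b : h (inl (y, b)) \in I.
  by rewrite inE; apply/existsP; exists (h (inl (y, ~~ b))); exact: hE.
have hI' y : h (inr y) \notin I by have := enum_valP y; rewrite inE.
have h_true_false y z : h (inl (y, true)) != h (inl (z, false)).
  apply/eqP => yz; have [ym Ey] := HP _ (enum_valP y).
  have [zm Ez] := HP _ (enum_valP z).
  have := hE y true; rewrite yz /= => /(Efun _ _ _ Ez) mz.
  by move: yz zm ym; rewrite /= mz => ->; lia.
have h_inj : injective h.
  move=> [[y b]|y] [[z b']|z] yz.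
  - have [bb|bb] := eqVneq b b'; last first.
      case: b b' bb yz => -[]// _ yz.
        by move: (h_true_false y z); rewrite yz eqxx.
      by move: (h_true_false z y); rewrite yz eqxx.
    suff /enum_val_inj -> : enum_val y = enum_val z by rewrite bb.
    move: yz; rewrite -bb; case: (b) => //= yz.
    apply: (Efun (m (enum_val y))); rewrite Esym.
      by have [] := HP _ (enum_valP y).
    by rewrite yz; have [] := HP _ (enum_valP z).
  - by have := hI y b; rewrite yz (negbTE (hI' z)).
  - by have := hI z b'; rewrite -yz (negbTE (hI' y)).
  - by move: yz => /= /enum_val_inj ->.
have h_surj i : exists x, h x = i.
  have [iI|iI] := boolP (i \in I); last first.
    have iC : i \in ~: I by rewrite inE.
    by exists (inr (enum_rank_in iC i)); rewrite /= enum_rankK_in.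
  move: (iI); rewrite inE => /existsP[j Eij].
  have [ij|ji|ij] := ltngtP i j; last first.
  - by move: Eij; rewrite (val_inj ij) Eirr.
  - have jH : j \in H by rewrite inE; apply/existsP; exists i; rewrite ji Esym.
    exists (inl (enum_rank_in jH j, true)); rewrite /= enum_rankK_in//.
    by apply: mP; rewrite Esym.
  - have iH : i \in H by rewrite inE; apply/existsP; exists j; rewrite ij.
    by exists (inl (enum_rank_in iH i, false)); rewrite /= enum_rankK_in.
have h_bij : bijective h.
  have [g gK] := choice h_surj.
  by exists g => [x|]; [apply: h_inj|]; rewrite ?gK.
have dE : d = (#|H|.*2 + #|~: I|)%N.
  rewrite -[LHS](card_ord d) -(bij_eq_card h_bij).
  by rewrite card_sum card_prod !card_ord card_bool muln2.
exists #|H|, #|~: I|, h; split=> // [i j|].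
  split=> [Eij|[x [b [-> ->]]]//].
  have [[[y b]|y] yi] := h_surj i.
    by exists y, b; split; rewrite -?yi//; apply: (Efun i); rewrite // -yi.
  have := hI' y; rewrite yi inE => /existsP[]; by exists j.
by have := cardsC I; rewrite card_ord => cI; move: dE; rewrite -{1}cI => /addIn.
Qed.

(** * Coordinates for products of hexagons and segments *)

(** The coordinates of a product of [k] hexagons and [c] segments: one pair
    for each hexagon, a single one for each segment. *)
Definition hex_index k c : finType := ('I_k * bool + 'I_c)%type.

(** A single coordinate is its own partner, so that its difference condition
    in [hex_body] reads [0 <= 1]. *)
Definition partner k c (x : hex_index k c) : hex_index k c :=
  match x with inl (y, b) => inl (y, ~~ b) | inr y => inr y end.

Definition hex_body (R : realType) k c : set (hex_index k c -> R) :=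
  [set r | forall x, -1 <= r x <= 1 /\ r x - r (partner x) <= 1].

(** Linear coordinates that identify the lattice [L] with the integral points
    and the polytope [Q] with the product of hexagons and segments. The
    polytopes of the theorem are compared through such coordinates. *)
Definition hex_coordinates (R : realType) (W : lmodType R) (L Q : set W) k c
    (co : W -> hex_index k c -> R) : Prop :=
  [/\ forall a w w' x, co (a *: w + w') x = a * co w x + co w' x,
      bijective co,
      forall w, L w <-> forall x, co w x \is a Num.int &
      forall w, Q w <-> hex_body (co w)].

Lemma hex_coordinates_iso (R : realType) (W W' : lmodType R) (L Q : set W)
    (L' Q' : set W') k c (co : W -> hex_index k c -> R)
    (co' : W' -> hex_index k c -> R) :
  hex_coordinates L Q co -> hex_coordinates L' Q' co' -> lattice_iso L Q L' Q'.
Proof.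
move=> [co_lin co_bij LP QP] [co'_lin [g' co'K g'K] LP' QP'].
pose f w := g' (co w).
have f_lin : linear f.
  move=> a w w'; apply: (can_inj co'K); apply/funext => x.
  by rewrite co'_lin /f !g'K co_lin.
pose fL : {linear W -> W'} := HB.pack f (GRing.isLinear.Build _ _ _ _ f f_lin).
have [g coK gK] := co_bij.
have fK w' : f (g (co' w')) = w' by rewrite /f gK co'K.
have image_f (A : set W) (A' : set W') :
    (forall w, A w <-> A' (f w)) -> f @` A = A'.
  move=> AA'; apply/seteqP; split=> [_ [w Aw <-]|w' A'w']; first exact/AA'.
  by exists (g (co' w')); rewrite ?fK//; apply/AA'; rewrite fK.
exists fL; split.
- by exists (fun w' => g (co' w')) => // w; rewrite /= /f g'K coK.
- by apply: image_f => w; rewrite LP LP' /f g'K.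
- by apply: image_f => w; rewrite QP QP' /f g'K.
Qed.

Lemma hex_coordinates_pullback (R : realType) (W W' : lmodType R) (L Q : set W)
    (L' Q' : set W') k c (co' : W' -> hex_index k c -> R) :
  lattice_iso L Q L' Q' -> hex_coordinates L' Q' co' ->
  exists co : W -> hex_index k c -> R, hex_coordinates L Q co.
Proof.
move=> [f [f_bij fL fQ]] [co'_lin co'_bij LP' QP'].
have preimage_f (A : set W) (A' : set W') : f @` A = A' ->
    forall w, A w <-> A' (f w).
  move=> <- w; split=> [Aw|[v Av /(bij_inj f_bij) <-]//]; by exists w.
exists (fun w => co' (f w)); split.
- by move=> a w w' x; rewrite linearP co'_lin.
- exact: bij_comp co'_bij f_bij.
- by move=> w; rewrite (preimage_f _ _ fL) LP'.
- by move=> w; rewrite (preimage_f _ _ fQ) QP'.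
Qed.

(** * The basis of a facet and the neighbouring facets *)

Lemma sign_eqE (R : realType) :
  ((-1 == 0 :> R) = false) * ((-1 == 1 :> R) = false) *
  ((0 == 1 :> R) = false) * ((0 == -1 :> R) = false) *
  ((1 == 0 :> R) = false) * ((1 == -1 :> R) = false).
Proof. by do !split; apply/eqP; lra. Qed.

(** The data of one facet: [u] is the corresponding vertex of the dual
    polytope and [e] the basis formed by the vertices of the facet. *)
Section Facet.
Context (R : realType) (V : vectType R) (M P : set V) (s : seq V) (d : nat).
Hypotheses (PE : P = conv_hull [set` s]) (dimV : \dim {:V} = d).
Hypotheses (d_gt0 : (0 < d)%N) (dimP : has_dim P d).
Hypotheses (simpP : is_simplicial P) (symP : centrally_symmetric P).
Hypothesis latP : vertices P `<=` M.
Hypothesis latD : vertices (dual_polytope P) `<=` dual_lattice M.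
Context (u : 'Hom(V, R^o)) (e : d.-tuple V).
Hypotheses (uv : vertices (dual_polytope P) u) (be : basis_of fullv e).
Hypothesis FE : [set x | P x /\ (u x : R) = -1] = conv_hull [set` e].

Let free_e : free e := basis_free be.

Lemma sym_mem x : P x -> P (- x).
Proof. by move=> Px; rewrite symP; exists x. Qed.

Lemma sym_vertex v : vertices P v -> vertices P (- v).
Proof.
move=> [f [c [fP vE]]]; exists (- f), c; split=> [x Px|].
  by rewrite opp_lfunE -linearN; apply/fP/sym_mem.
apply/seteqP; split=> x /=.
  move=> ->; have [Pv fv] : P v /\ (f v : R) = c.
    by have: [set v] v by []; rewrite vE.
  by split; [exact: sym_mem|rewrite opp_lfunE linearN opprK].
move=> [Px fx]; have : [set v] (- x).
  by rewrite vE; split; [exact: sym_mem|rewrite linearN -opp_lfunE].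
by move=> <-; rewrite opprK.
Qed.

(** If the origin were a vertex, a functional exposing it would vanish on
    [P = - P], so that [P] would be reduced to a point. *)
Lemma vertex_neq0 v : vertices P v -> v != 0.
Proof.
move=> vv; have Pv := vertex_in vv; case: vv => f [c [fP vE]].
apply/eqP => v0.
have [_ fv] : P v /\ (f v : R) = c by have: [set v] v by []; rewrite vE.
have c0 : c = 0 by rewrite -fv v0 linear0.
have P0 x : P x -> x = v.
  move=> Px; have : [set v] x; last by [].
  rewrite vE; split=> //; rewrite c0; apply/le_anti; rewrite -{1}c0 fP//=.
  by have := fP _ (sym_mem Px); rewrite c0 linearN oppr_le0.
have spanX := dual_vertex_span PE uv.
suff : (({:V} : {vspace V}) <= 0)%VS.
  by rewrite subv0 => /eqP fv0; move: d_gt0; rewrite -dimV fv0 dimv0.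
rewrite -spanX; apply/span_subvP => x; rewrite mem_filter => /andP[_ xs].
by rewrite memv0 (P0 _ (generator_mem PE xs)) v0.
Qed.

Lemma facet_basis (i : 'I_d) : P e`_i /\ (u e`_i : R) = -1.
Proof.
have : conv_hull [set` e] e`_i.
  by apply: conv_hull_sub; rewrite /= mem_nth ?size_tuple.
by rewrite -FE.
Qed.

Lemma facet_coord x : P x -> (u x : R) = -1 ->
  (forall i, 0 <= coord e i x) /\ \sum_i coord e i x = 1.
Proof. by move=> Px ux; apply: conv_basis_coord; rewrite -?FE. Qed.

(** Among the points of the facet [u = -1] the vertex [e_i] is the only one
    with the largest [i]-th barycentric coordinate. *)
Lemma facet_basis_vertex (i : 'I_d) : vertices P e`_i.
Proof.
have [Pe ue] := facet_basis i.
rewrite PE; apply: (@lexicographic_vertex _ _ _ (- u) (dual_vector e i)).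
- by rewrite -PE.
- move=> p /(generator_mem PE) Pp; rewrite !opp_lfunE lerN2 ue.
  exact: (vertex_in uv).
move=> p /(generator_mem PE) Pp; rewrite !opp_lfunE ue => /oppr_inj up pe.
have [c0 c1] := facet_coord Pp up.
rewrite !dual_vectorE coord_free// eqxx lt_neqAle.
have sum_other : 1 - coord e i p = \sum_(j | j != i) coord e j p.
  by rewrite -c1 (bigD1 i)//= addrAC subrr add0r.
rewrite -subr_ge0 sum_other sumr_ge0// andbT -subr_eq0 -oppr_eq0 opprB.
rewrite sum_other psumr_eq0//; apply: contra pe => /allP cj.
have cji j : j != i -> coord e j p = 0.
  by move=> ji; have := cj j; rewrite mem_index_enum ji => /(_ isT)/eqP.
rewrite (coord_basis be (memvf p)) (bigD1 i)//= big1 => [|j /cji->]; last first.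
  by rewrite scale0r.
have -> : coord e i p = 1.
  move: sum_other; rewrite big1 => [/eqP|j /cji//].
  by rewrite subr_eq0 => /eqP.
by rewrite scale1r addr0.
Qed.

(** The functional [u + lam *: e_i^*] stays equal to [-1] at [e_j] for
    [j != i], and [lam] is increased until another point [q] of [P] becomes
    tight. The [e_j] and [q] span [V], which makes the new functional a
    vertex. *)
Lemma facet_neighbour (i : 'I_d) :
  exists2 lam : R, 0 < lam &
    vertices (dual_polytope P) (u + lam *: dual_vector e i).
Proof.
have Pu := vertex_in uv.
pose T := [seq p <- s | coord e i p < 0].
have Tn0 : T != [::].
  apply/eqP => T0; have := sym_mem (facet_basis i).1.
  rewrite PE => /(conv_hull_ge (f := dual_vector e i) (c := 0)).
  rewrite dual_vectorE linearN/= coord_free// eqxx oppr_ge0 ler10 => c0.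
  suff: false by [].
  apply: c0 => p ps; rewrite dual_vectorE leNgt; apply/negP => cp.
  have : p \in T by rewrite mem_filter cp.
  by rewrite T0.
have [q qT qmin] := seq_argmax
  (fun p => (1 + (u p : R)) / coord e i p) Tn0.
have TP p : p \in T -> P p /\ coord e i p < 0.
  by rewrite mem_filter => /andP[-> /(generator_mem PE)].
have [Pq cq] := TP _ qT.
(* The smallest parameter at which [u + lam *: e_i^*] reaches the value [-1] at
   one of the generators in [T]. *)
pose lam := - ((1 + (u q : R)) / coord e i q).
have u'E x :
    (u + lam *: dual_vector e i) x = (u x : R) + lam * coord e i x :> R.
  by rewrite add_lfunE scale_lfunE dual_vectorE.
have lam_ge0 : 0 <= lam.
  rewrite oppr_ge0 mulr_ge0_le0//; last by rewrite invr_le0 ltW.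
  by rewrite -lerBlDl sub0r; exact: Pu.
have u'q : (u + lam *: dual_vector e i) q = -1 :> R.
  by rewrite u'E /lam mulNr divfK ?lt_eqF//; ring.
exists lam.
  rewrite lt_def lam_ge0 andbT oppr_eq0 mulf_neq0//.
    apply/eqP => uq; have uq1 : (u q : R) = -1.
      by apply/eqP; rewrite -addr_eq0 addrC uq.
    by have [/(_ i)] := facet_coord Pq uq1; rewrite leNgt cq.
  by rewrite invr_eq0 lt_eqF.
apply: (dual_vertexP (X := q :: [seq e`_j | j : 'I_d <- enum 'I_d & j != i])).
- apply: (dual_polytopeP PE) => p ps; rewrite u'E.
  have [cp|cp] := ltP (coord e i p) 0.
    have pT : p \in T by rewrite mem_filter cp.
    have := qmin p pT; rewrite -[X in _ <= X]opprK -/lam.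
    rewrite ler_ndivrMr//; move: (u p : R) => x; lra.
  have := Pu p (generator_mem PE ps); have := mulr_ge0 lam_ge0 cp.
  by move: (u p : R) => x; lra.
- move=> x; rewrite inE => /predU1P[->//|/mapP[j]].
  rewrite mem_filter => /andP[ji _] ->.
  split; first by have [] := facet_basis j.
  rewrite u'E (facet_basis j).2 coord_free//. rewrite (negbTE ji).
  by rewrite mulr0 addr0.
- set X := _ :: _.
  have eX j : j != i -> e`_j \in <<X>>%VS.
    move=> ji; apply: memv_span; rewrite inE; apply/orP; right.
    by apply/mapP; exists j; rewrite // mem_filter ji mem_enum.
  have eiX : e`_i \in <<X>>%VS.
    have : coord e i q *: e`_i \in <<X>>%VS.
      have -> : coord e i q *: e`_i = q - \sum_(j | j != i) coord e j q *: e`_j.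
        by rewrite {2}(coord_basis be (memvf q)) (bigD1 i)//= addrK.
      apply: memvB; first exact/memv_span/mem_head.
      by apply: memv_suml => j ji; rewrite memvZ// eX.
    by rewrite rpredZeq lt_eqF.
  apply/eqP; rewrite eqEsubv subvf/=; apply/subvP => x _.
  rewrite (coord_basis be (memvf x)); apply: memv_suml => j _; rewrite memvZ//.
  by have [->//|/eX] := eqVneq j i.
Qed.

(** The facet of [u'] has only [d] vertices, and [d - 1] of them are the
    [e_j], [j != i]. *)
Lemma neighbour_vertex_unique (i : 'I_d) (u' : 'Hom(V, R^o)) v w :
  vertices (dual_polytope P) u' ->
  (forall j : 'I_d, j != i -> (u' e`_j : R) = -1) ->
  vertices P v -> (u' v : R) = -1 -> (forall j : 'I_d, j != i -> v != e`_j) ->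
  vertices P w -> (u' w : R) = -1 -> (forall j : 'I_d, j != i -> w != e`_j) ->
  v = w.
Proof.
move=> u'v u'e vv u'v1 ve wv u'w1 we.
have [e' be' FE'] := dual_vertex_basis PE dimV d_gt0 dimP simpP u'v.
have mem_e' x : vertices P x -> (u' x : R) = -1 -> x \in tval e'.
  exact: tight_vertex_mem.
apply/eqP/negP => /negP vw.
pose X := [seq e`_j | j : 'I_d in predC1 i].
have notX x : (forall j : 'I_d, j != i -> x != e`_j) -> x \notin X.
  move=> xe; apply/fintype.imageP => -[j]; rewrite inE => ji xE.
  by move: (xe j ji); rewrite xE eqxx.
have uniqX : uniq X.
  rewrite map_inj_uniq ?enum_uniq// => j k /eqP.
  by rewrite nth_uniq ?size_tuple ?free_uniq// => /eqP/val_inj.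
have : (size (v :: w :: X) <= size (tval e'))%N.
  apply: uniq_leq_size => [|x].
    by rewrite /= inE negb_or vw !notX// uniqX.
  rewrite !inE => /or3P[/eqP->|/eqP->|/fintype.imageP[j]]; try exact: mem_e'.
  rewrite inE => ji ->.
  by apply: mem_e'; [exact: facet_basis_vertex|exact: u'e].
have -> : size (v :: w :: X) = (#|predC1 i|).+2.
  by rewrite /= size_image.
by rewrite size_tuple cardC1 card_ord prednK// ltnn.
Qed.

Lemma integral_value (f : 'Hom(V, R^o)) v :
  vertices (dual_polytope P) f -> vertices P v -> (f v : R) \is a Num.int.
Proof. by move=> /latD fN /latP vM; exact: fN. Qed.

Lemma facet_levelE x : u x = - \sum_i coord e i x :> R.
Proof.
rewrite {1}(coord_basis be (memvf x)) functional_combination -sumrN.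
by apply: eq_bigr => i _; rewrite (facet_basis i).2 mulrN1.
Qed.

(** With [u' = u + lam *: e_i^*] the value [u' v = lam * coord e i v] is a
    negative integer that is at least [-1], so [v] lies on the neighbouring
    facet. Moreover [lam] is [1] or [2], because [- e_i] belongs to [P]; if
    it were [2], then [- e_i] would be the new vertex of the neighbouring
    facet, hence equal to [v], although [u (- e_i) = 1]. *)
Lemma level_zero_coord (i : 'I_d) v :
  vertices P v -> (u v : R) = 0 -> coord e i v < 0 ->
  [/\ coord e i v = -1, dual_lattice M (dual_vector e i) &
      forall w, vertices P w -> (u w : R) = 0 -> coord e i w < 0 -> w = v].
Proof.
move=> vv uv0 cv; have [lam lam0 u'v] := facet_neighbour i.
set u' := u + _ in u'v.
have u'E x : u' x = (u x : R) + lam * coord e i x :> R.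
  by rewrite add_lfunE scale_lfunE dual_vectorE.
have [Pe ue] := facet_basis i.
have ce : coord e i e`_i = 1 by rewrite coord_free// eqxx.
have lam_int : lam \is a Num.int.
  have := integral_value u'v (facet_basis_vertex i).
  by rewrite u'E ue ce mulr1 addrC rpredBr// rpred1.
have u'e (j : 'I_d) : j != i -> (u' e`_j : R) = -1.
  move=> ji; rewrite u'E (facet_basis j).2 coord_free// (negbTE ji).
  by rewrite mulr0 addr0.
have ne (w : V) : (u w : R) != -1 -> forall j : 'I_d, j != i -> w != e`_j.
  by move=> uw j _; apply: contraNneq uw => ->; rewrite (facet_basis j).2.
have low (w : V) : vertices P w -> (u w : R) = 0 -> coord e i w < 0 ->
    (u' w : R) = -1 /\ lam * coord e i w = -1.
  move=> wv uw cw; have := integral_value u'v wv.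
  have := vertex_in u'v _ (vertex_in wv); rewrite u'E uw add0r.
  have : lam * coord e i w < 0 by rewrite pmulr_rlt0.
  move: (lam * _) => x x0 x1 /intrP[m xm]; rewrite xm in x0 x1 *.
  suff -> : m = -1 by [].
  by move: x0 x1; rewrite -(rmorphN1 (intmul 1)) ler_int ltrz0; lia.
have uniq_low (w : V) : vertices P w -> (u' w : R) = -1 -> (u w : R) != -1 ->
    w = v.
  move=> wv u'w uw; apply: (neighbour_vertex_unique u'v u'e) => //.
  - exact: ne.
  - exact: (low v _ _ _).1.
  - by apply: ne; rewrite uv0 eq_sym oppr_eq0 oner_eq0.
have lam1 : lam = 1.
  have lam2 : lam <= 2.
    have := vertex_in u'v _ (sym_mem Pe); rewrite u'E !linearN/= ue ce.
    by move: (lam) => l; lra.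
  have lamn2 : lam != 2.
    apply/eqP => l2; have /uniq_low : vertices P (- e`_i).
      exact/sym_vertex/facet_basis_vertex.
    rewrite u'E !linearN/= ue ce l2 => vE.
    have : - e`_i = v by apply: vE; [ring|apply/eqP; lra].
    by move/(congr1 (fun x => u x : R)); rewrite linearN/= ue uv0; lra.
  move: lam_int lam0 lam2 lamn2 => /intrP[m ->].
  rewrite -[2]/(2%:~R) -[1]/(1%:~R) ltr0z ler_int eqr_int.
  by move=> m0 m2 mn; congr (_%:~R); lia.
split.
- by have [_] := low v vv uv0 cv; rewrite lam1 mul1r.
- have -> : dual_vector e i = u' - u.
    by rewrite /u' lam1 scale1r addrAC subrr add0r.
  move=> x Mx; rewrite add_lfunE opp_lfunE rpredB//.
    exact: (latD u'v).
  exact: (latD uv).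
- move=> w wv uw cw; apply: uniq_low => //; first exact: (low w _ _ _).1.
  by rewrite uw eq_sym oppr_eq0 oner_eq0.
Qed.

Lemma vertex_level v :
  vertices P v -> [\/ (u v : R) = -1, (u v : R) = 0 | (u v : R) = 1].
Proof.
move=> vv; have := vertex_in uv _ (vertex_in vv).
have := vertex_in uv _ (vertex_in (sym_vertex vv)); rewrite linearN/=.
have /intrP[m ->] := integral_value uv vv.
rewrite lerN2 -(rmorphN1 (intmul 1)) -[1]/(1%:~R) !ler_int => m1 m2.
have : (m == -1) || (m == 0) || (m == 1) by lia.
by case/orP=> [/orP[]|] /eqP ->; [constructor 1|constructor 2|constructor 3].
Qed.

Lemma level_zero_coordP (i : 'I_d) v :
  vertices P v -> (u v : R) = 0 ->
  [\/ coord e i v = -1, coord e i v = 0 | coord e i v = 1].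
Proof.
move=> vv uv0; have [cv|cv|->] := ltgtP (coord e i v) 0; last by constructor 2.
  by constructor 1; have [] := level_zero_coord vv uv0 cv.
constructor 3; have [||c1 _ _] := @level_zero_coord i (- v) (sym_vertex vv).
- by rewrite linearN/= uv0 oppr0.
- by rewrite linearN/= oppr_lt0.
- by move: c1; rewrite linearN/= => /oppr_inj.
Qed.

(** * The vertices at level zero *)

Context (vs : seq V).
Hypotheses (uniq_vs : uniq vs) (vsP : forall v, v \in vs <-> vertices P v).

Definition equator := [seq v <- vs | (u v : R) == 0].

Lemma equatorP v : v \in equator <-> vertices P v /\ (u v : R) = 0.
Proof.
rewrite mem_filter; split=> [/andP[/eqP uv0 /vsP]|[/vsP -> ->]]//.
by rewrite eqxx.
Qed.

Lemma equatorN v : v \in equator -> - v \in equator.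
Proof.
move=> /equatorP[vv uv0]; apply/equatorP; split; first exact: sym_vertex.
by rewrite linearN/= uv0 oppr0.
Qed.

Lemma size_vertices : size vs = (d.*2 + size equator)%N.
Proof.
have low : perm_eq [seq v <- vs | (u v : R) == -1] e.
  apply: uniq_perm => [||v]; [exact: filter_uniq|exact: free_uniq|].
  apply/idP/idP; rewrite mem_filter.
    by move=> /andP[/eqP uv1 /vsP vv]; exact: tight_vertex_mem FE vv uv1.
  move=> /tnthP[i ->]; rewrite (tnth_nth 0) (facet_basis i).2 eqxx.
  exact/vsP/facet_basis_vertex.
have high : perm_eq [seq v <- vs | (u v : R) == 1] [seq - v | v <- e].
  apply: uniq_perm => [||v]; first exact: filter_uniq.
    by rewrite (map_inj_uniq oppr_inj) free_uniq.
  apply/idP/mapP; rewrite mem_filter.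
    move=> /andP[/eqP uv1 /vsP vv]; exists (- v); rewrite ?opprK//.
    apply: tight_vertex_mem FE (sym_vertex vv) _.
    by rewrite linearN/= uv1.
  move=> [w /tnthP[i ->] ->]; rewrite (tnth_nth 0) linearN/= (facet_basis i).2.
  by rewrite opprK eqxx; exact/vsP/sym_vertex/facet_basis_vertex.
have := perm_size low; have := perm_size high.
rewrite size_map !size_tuple /equator !size_filter => high_d low_d.
rewrite -addnn -{1}low_d -{1}high_d.
have : {in vs, forall v, [|| (u v : R) == -1, (u v : R) == 0 | (u v : R) == 1]}.
  by move=> v /vsP/vertex_level[] ->; rewrite eqxx ?orbT.
elim: (vs) => //= v t IH H; rewrite IH => [|w wt]; last first.
  by apply: H; rewrite inE wt orbT.
have := H v (mem_head _ _); move: (u v : R) => a.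
have [->|_] := eqVneq a (-1).
  by rewrite !sign_eqE; lia.
have [->|_] := eqVneq a 0.
  by rewrite !sign_eqE; lia.
by move=> /= ->; lia.
Qed.

Definition negative_coords (v : V) : {set 'I_d} :=
  [set i | coord e i v == -1]%SET.

Lemma equator_coordP i v :
  v \in equator -> [\/ coord e i v = -1, coord e i v = 0 | coord e i v = 1].
Proof. by move=> /equatorP[]; exact: level_zero_coordP. Qed.

Lemma negative_coords_disjoint v w i :
  v \in equator -> w \in equator ->
  i \in negative_coords v -> i \in negative_coords w -> v = w.
Proof.
move=> /equatorP[vv uv0] /equatorP[wv uw0]; rewrite !inE => /eqP cv /eqP cw.
have lt_m1 : (-1 : R) < 0 by rewrite oppr_lt0.
have [|_ _ H] := @level_zero_coord i w wv uw0; first by rewrite cw.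
by apply: H; rewrite ?cv.
Qed.

(** The coordinates of [v] sum to zero and are [-1], [0] or [1]. *)
Lemma card_negative_coordsN v :
  v \in equator -> #|negative_coords (- v)| = #|negative_coords v|.
Proof.
move=> vZ; apply/eqP; rewrite -(eqr_nat R) -subr_eq0.
have /equatorP[_ uv0] := vZ.
have : \sum_i coord e i v = 0.
  by apply/eqP; rewrite -oppr_eq0 -facet_levelE uv0.
have -> : \sum_i coord e i v =
    \sum_i (i \in negative_coords (- v))%:R -
    \sum_i (i \in negative_coords v)%:R.
  rewrite -sumrB; apply: eq_bigr => i _; rewrite !inE linearN/= eqr_opp.
  by have [] := equator_coordP i vZ => ->;
    rewrite ?eqxx ?sign_eqE /= ?sub0r ?subr0 ?oppr0.
have sum_mem (A : {set 'I_d}) : \sum_i (i \in A)%:R = #|A|%:R :> R.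
  rewrite -sum1_card natr_sum [RHS]big_mkcond.
  by apply: eq_bigr => i _; case: (_ \in _).
by rewrite !sum_mem => ->.
Qed.

Lemma negative_coords_gt0 v : v \in equator -> (0 < #|negative_coords v|)%N.
Proof.
move=> vZ; rewrite lt0n; apply/negP => /eqP c0.
have no w : w \in equator -> #|negative_coords w| = 0%N ->
    forall i, coord e i w <> -1.
  move=> wZ /eqP; rewrite cards_eq0 => /eqP w0 i ci.
  by have : i \in negative_coords w; [rewrite inE ci|rewrite w0 inE].
have /equatorP[/vertex_neq0 /eqP[]] := vZ.
rewrite (coord_basis be (memvf v)) big1// => i _.
have [ci|->|ci] := equator_coordP i vZ; last 2 first.
- by rewrite scale0r.
- have [] := no _ (equatorN vZ) _ i; first by rewrite card_negative_coordsN.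
  by rewrite linearN/= ci.
by have [] := no _ vZ c0 i.
Qed.

Lemma equatorNneq v : v \in equator -> - v != v.
Proof.
move=> /equatorP[/vertex_neq0 v0 _]; apply: contra v0 => /eqP vv.
have : (2 : R) *: v = 0 by rewrite scaler_nat mulr2n -{1}vv addNr.
by move/eqP; rewrite scaler_eq0 pnatr_eq0.
Qed.

Lemma equator_form v :
  v \in equator -> #|negative_coords v| = 1%N ->
  exists i j : 'I_d, v = e`_j - e`_i :> V.
Proof.
move=> vZ cv.
have : #|negative_coords (- v)| == 1%N by rewrite card_negative_coordsN ?cv.
move: cv => /eqP /cards1P[i iE] /cards1P[j jE].
have ci k : (coord e k v == -1) = (k == i).
  by have /finset.setP/(_ k) := iE; rewrite !inE.
have cj k : (coord e k v == 1) = (k == j).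
  by have /finset.setP/(_ k) := jE; rewrite !inE linearN/= eqr_opp.
have ij : j != i.
  by rewrite -ci; move: (cj j); rewrite eqxx => /eqP->; rewrite sign_eqE.
exists i, j; rewrite {1}(coord_basis be (memvf v)) (bigD1 j)//=.
rewrite (bigD1 i)/=; last by rewrite eq_sym.
have := ci i; rewrite eqxx => /eqP->; have := cj j; rewrite eqxx => /eqP->.
rewrite scale1r scaleN1r big1 ?addr0// => k /andP[kj ki].
have [/eqP|->|/eqP] := equator_coordP k vZ; rewrite ?scale0r//.
  by rewrite ci (negbTE ki).
by rewrite cj (negbTE kj).
Qed.

(** For odd [d] the bound [d] cannot be attained: the equator would then be a
    perfect matching of an odd number of indices. *)
Lemma equator_bound : (size equator + odd d <= d)%N /\
  ((d <= (size equator).+1)%N ->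
   exists k c (h : hex_index k c -> 'I_d),
     [/\ bijective h,
         forall v, v \in equator <->
           exists x b, v = e`_(h (inl (x, ~~ b))) - e`_(h (inl (x, b))) :> V,
         size equator = k.*2 & d = (k.*2 + c)%N]).
Proof.
have uniq_eq : uniq equator by exact: filter_uniq.
have le_d : (size equator <= d)%N.
  apply: leq_trans (disjoint_family_bound uniq_eq negative_coords_disjoint).
  rewrite -sum1_size [leqLHS]big_seq [leqRHS]big_seq.
  by apply: leq_sum => v /negative_coords_gt0.
suff tight : (d <= (size equator).+1)%N ->
   exists k c (h : hex_index k c -> 'I_d),
     [/\ bijective h,
         forall v, v \in equator <->
           exists x b, v = e`_(h (inl (x, ~~ b))) - e`_(h (inl (x, b))) :> V,
         size equator = k.*2 & d = (k.*2 + c)%N].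
  split=> //; have [d1|d1] := ltnP (size equator).+1 d.
    by apply: leq_trans (ltnW d1); rewrite -addn1 leq_add2l leq_b1.
  have [k [c [_ [_ _ sE dE]]]] := tight d1.
  have : odd d = odd c by rewrite dE oddD odd_double.
  rewrite sE in d1 le_d *; move: (odd d) => b bE; subst b.
  by case: c dE => [|c] dE; rewrite /= dE; lia.
move=> dle.
have card1 := disjoint_family_tight (opp := -%R) uniq_eq
  negative_coords_disjoint negative_coords_gt0 _ dle.
have {}card1 v : v \in equator -> #|negative_coords v| = 1%N.
  apply: card1 => w wZ; split; [exact: equatorN|exact: equatorNneq|].
  exact: card_negative_coordsN.
have coE (i j k : 'I_d) : coord e k (e`_j - e`_i) = (j == k)%:R - (i == k)%:R.
  by rewrite linearB/= !coord_free.
pose E := [rel i j : 'I_d | e`_j - e`_i \in equator].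
have Eirr : irreflexive E.
  move=> i; rewrite /= subrr; apply/negP => /equatorP[/vertex_neq0].
  by rewrite eqxx.
have Esym : symmetric E.
  by move=> i j; apply/idP/idP => /equatorN; rewrite opprB.
have Eneq i j : E i j -> (j == i) = false.
  by apply: contraTF => /eqP ->; exact/negbT/Eirr.
have Eneg i j : E i j -> i \in negative_coords (e`_j - e`_i).
  by move=> Eij; rewrite inE coE (Eneq _ _ Eij) eqxx sub0r.
have Efun i j k : E i j -> E i k -> j = k.
  move=> Eij Eik.
  have := negative_coords_disjoint Eij Eik (Eneg _ _ Eij) (Eneg _ _ Eik).
  move=> /addIr/eqP; rewrite nth_uniq ?size_tuple ?free_uniq//.
  by move=> /eqP/val_inj.
have [k [c [h [h_bij EP cE dE]]]] := matching_enum Esym Eirr Efun.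
exists k, c, h; split=> //.
  move=> v; split=> [vZ|[x [b ->]]].
    have [i [j vE]] := equator_form vZ (card1 v vZ).
    have /EP[x [b [iE jE]]] : E i j by rewrite /= -vE.
    by exists x, b; rewrite -iE -jE.
  have : E (h (inl (x, b))) (h (inl (x, ~~ b))) by apply/EP; exists x, b.
  by [].
pose m i := odflt i [pick j | E i j].
have mP i j : E i j -> m i = j.
  by rewrite /m; case: pickP => [l Eil|/(_ j)->//] Eij; exact: Efun Eil Eij.
(* Equator vertices correspond to the matched indices via their only negative
   coordinate. *)
have perm_eqm : perm_eq equator
    [seq e`_(m i) - e`_i | i in [set i | [exists j, E i j]]%SET].
  apply: uniq_perm => // [|v].
    rewrite map_inj_in_uniq ?enum_uniq// => i i'; rewrite !mem_enum !inE.
    move=> /existsP[j Eij] /existsP[j' Eij'].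
    rewrite (mP _ _ Eij) (mP _ _ Eij').
    move=> vv; have := Eneg _ _ Eij; rewrite vv inE coE.
    have [-> //|_] := eqVneq i' i; have [_|_] := eqVneq j' i.
      by rewrite subr0 sign_eqE.
    by rewrite subr0 sign_eqE.
  apply/idP/fintype.imageP => [vZ|[i]].
    have [i [j vE]] := equator_form vZ (card1 v vZ).
    have Eij : E i j by rewrite /= -vE.
    by exists i; rewrite ?inE ?(mP _ _ Eij)//; apply/existsP; exists j.
  by rewrite inE => /existsP[j Eij] ->; rewrite (mP _ _ Eij).
by rewrite (perm_size perm_eqm) size_image.
Qed.

(** * Extremal polytopes *)

Lemma dual_polytope_vertices (f : 'Hom(V, R^o)) :
  dual_polytope P f <-> {in vs, forall v, -1 <= (f v : R)}.
Proof.
split=> [Pf v /vsP/vertex_in/Pf//|fvs x Px].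
have s0 : s != [::].
  apply/eqP => s0; have := Px; rewrite PE s0 => -[[|n] [p [t [sp _ t1 _]]]].
    by move/eqP: t1; rewrite big_ord0 sign_eqE.
  by have := sp ord0.
have [v vv vmax] := vertex_maximizing (- f) s0.
rewrite -PE in vv vmax; have := vmax x Px; rewrite !opp_lfunE lerN2.
by apply: le_trans; apply/fvs/vsP.
Qed.

Lemma dual_lattice_vertex (f : 'Hom(V, R^o)) v :
  dual_lattice M f -> vertices P v -> (f v : R) \is a Num.int.
Proof. by move=> fN /latP; exact: fN. Qed.

Lemma functional_coordE (f : 'Hom(V, R^o)) x :
  f x = \sum_i coord e i x * (f e`_i : R) :> R.
Proof. by rewrite {1}(coord_basis be (memvf x)) functional_combination. Qed.

(** The dual basis vectors of matched indices are integral by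
    [level_zero_coord]. At most one index is unmatched, and its dual basis
    vector is integral as well because [- u] is the sum of all of them. *)
Lemma equality_hex_coordinates :
  (3 * d <= size vs + odd d)%N ->
  exists co : 'Hom(V, R^o) -> hex_index d./2 (odd d) -> R,
    hex_coordinates (dual_lattice M) (dual_polytope P) co.
Proof.
rewrite size_vertices => dle; have [le_d matched] := equator_bound.
have [|k [c [h [h_bij equatorE sE dE]]]] := matched.
  by move: (odd d) dle => -[]; lia.
have cE : c = odd d.
  have := oddD k.*2 c; rewrite -dE odd_double /= => oddE.
  rewrite sE in dle le_d; rewrite oddE in dle le_d *.
  by case: c {h h_bij equatorE} dE oddE dle le_d => [|[|c]]//=; lia.
have kE : k = d./2 by rewrite dE cE addnC half_bit_double.
rewrite -kE -cE.
have c1 : (c <= 1)%N by rewrite cE leq_b1.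
exists (fun f x => f e`_(h x)).
have h_surj i : exists x, h x = i by case: h_bij => g _ gK; exists (g i).
have eqM x b : e`_(h (inl (x, ~~ b))) - e`_(h (inl (x, b))) \in equator.
  by apply/equatorE; exists x, b.
split.
- by move=> a f g x; rewrite add_lfunE scale_lfunE.
- have [g hK gK] := h_bij.
  have /choice[F FE0] : forall r : hex_index k c -> R, exists f : 'Hom(V, R^o),
      forall x, f x = \sum_i r (g i) * coord e i x :> R.
    move=> r; apply: functional_exists => a x y.
    rewrite mulr_sumr -big_split/=; apply: eq_bigr => i _.
    by rewrite linearP/= mulrDr mulrCA.
  have Fe r (i : 'I_d) : F r e`_i = r (g i) :> R.
    rewrite FE0 (bigD1 i)//= coord_free// eqxx mulr1 big1 ?addr0// => j ji.
    by rewrite coord_free// eq_sym (negbTE ji) mulr0.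
  exists F => [f|r].
    by apply: (functional_eq be) => i; rewrite Fe gK.
  by apply/funext => x; rewrite Fe hK.
- move=> f; split=> [fN x|fint x Mx].
    exact: dual_lattice_vertex fN (facet_basis_vertex _).
  rewrite functional_coordE rpred_sum// => i _.
  have [y <-] := h_surj i; rewrite rpredM//.
  have matched_int z b : coord e (h (inl (z, b))) x \is a Num.int.
    have /equatorP[vv uv0] := eqM z b.
    have [|_ N _] := level_zero_coord (i := h (inl (z, b))) vv uv0.
      rewrite linearB/= !coord_free// eqxx (inj_eq (bij_inj h_bij)).
      case: eqP => [[]|_]; first by case: (b).
      by rewrite sub0r oppr_lt0.
    by rewrite -dual_vectorE; exact: N.
  case: y => [[z b]|y]; first exact: matched_int.
  (* The unmatched index, expressed through [u] and the matched ones. *)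
  have := facet_levelE x; rewrite (bigD1 (h (inr y)))//= opprD => uE.
  have -> : coord e (h (inr y)) x =
      - (u x : R) - \sum_(i | i != h (inr y)) coord e i x.
    by rewrite [u x]uE opprD !opprK addrK.
  rewrite rpredB ?rpredN//; first exact: (latD uv).
  apply: rpred_sum => j; have [[[z b]|z] <-] := h_surj j => jy.
    exact: matched_int.
  case/eqP: jy; congr (h (inr _)); apply/val_inj.
  by move: (ltn_ord y) (ltn_ord z) c1 => /=; lia.
- move=> f; rewrite dual_polytope_vertices; split=> [fvs x|fb v /vsP vv].
    have fe (i : 'I_d) : -1 <= (f e`_i : R) <= 1.
      rewrite fvs; last by apply/vsP/facet_basis_vertex.
      have /vsP/fvs := sym_vertex (facet_basis_vertex i).
      by rewrite linearN/= lerN2.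
    split=> //; case: x => [[y b]|y] /=; last by rewrite subrr ler01.
    have /equatorP[vv _] := eqM y b.
    by have /vsP/fvs := vv; rewrite linearB/= -[leRHS]opprB lerN2.
  have fe (i : 'I_d) : -1 <= (f e`_i : R) <= 1.
    by have [x <-] := h_surj i; have [] := fb x.
  have mem_e w : w \in tval e -> -1 <= (f w : R) <= 1.
    by move=> /tnthP[i ->]; rewrite (tnth_nth 0).
  have [uv1|uv0|uv1] := vertex_level vv.
  + by have /mem_e/andP[] := tight_vertex_mem FE vv uv1.
  + have /equatorE[y [b ->]] : v \in equator by apply/equatorP.
    have [_] := fb (inl (y, b)); by rewrite /= -lerN2 opprB linearB.
  + have : - v \in tval e.
      by apply: tight_vertex_mem FE (sym_vertex vv) _; rewrite linearN/= uv1.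
    by move=> /mem_e/andP[_]; rewrite linearN/= lerNl.
Qed.
End Facet.

(** * Counting facets *)

(** Let [w] lie on the hyperplane [l k = -1] and strictly inside all the
    other half-spaces of the first system. Some inequality [-1 <= a v] must
    be tight at [w], otherwise [w] could be scaled up; as it holds near [w]
    on the whole hyperplane, [a v] vanishes wherever [l k] does, so that
    [a v = l k]. Distinct [k] therefore need distinct [v]. *)
Lemma facet_functionals_bound (R : realType) (W : lmodType R) (K : finType)
    (T : eqType) (s : seq T) (l : K -> W -> R) (a : T -> W -> R) :
  (forall k t w w', l k (t *: w + w') = t * l k w + l k w') ->
  (forall v t w w', a v (t *: w + w') = t * a v w + a v w') ->
  (forall w, (forall k, -1 <= l k w) <-> {in s, forall v, -1 <= a v w}) ->
  (forall k, exists w, l k w = -1 /\ forall k', k' != k -> -1 < l k' w) ->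
  (#|K| <= size s)%N.
Proof.
move=> l_lin a_lin same wit.
have /choice[F FP] : forall k, exists v, v \in s /\ forall z, a v z = l k z.
  move=> k; have [w [lkw lw]] := wit k.
  have Qw k' : -1 <= l k' w.
    by have [->|/lw/ltW//] := eqVneq k' k; rewrite lkw.
  have [v vs avw] : exists2 v, v \in s & a v w = -1.
    apply: contrapT => no.
    have aw v : v \in s -> 0 < a v w + 1.
      move=> vs; rewrite lt_def addr_eq0; apply/andP; split.
        by apply/eqP => av; apply: no; exists v.
      by rewrite -lerBlDr sub0r; exact: (iffLR (same w)).
    have [eps eps0 epsP] := small_scale (fun v => a v w) aw.
    have /same/(_ k) : {in s, forall v, -1 <= a v (eps *: w + w)}.
      move=> v vs; rewrite a_lin; have := epsP v vs.
      rewrite -{1}(gtr0_norm eps0) -normrM ltr_norml => /andP[+ _].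
      by move: (eps * a v w) (a v w) => x y; lra.
    by rewrite l_lin lkw; move: eps0; lra.
  exists v; split=> // z.
  (* Where [l k] vanishes, so does [a v], since small moves in both directions
     stay inside. *)
  have flat y : l k y = 0 -> a v y = 0.
    move=> ly0.
    have [|eps eps0 epsP] := @small_scale R _ [seq k' <- enum K | k' != k]
        (fun k' => l k' w + 1) (fun k' => l k' y).
      move=> k'; rewrite mem_filter => /andP[/lw + _].
      by rewrite -subr_gt0 opprK.
    have side t : `|t| = eps -> -1 <= a v (t *: y + w).
      move=> teps; apply: (iffLR (same _)) => // k'; rewrite l_lin.
      have [->|k'k] := eqVneq k' k; first by rewrite ly0 lkw mulr0 add0r.
      have := epsP k'; rewrite mem_filter k'k mem_enum => /(_ isT).
      rewrite -teps -normrM ltr_norml => /andP[+ _].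
      by move: (t * l k' y) (l k' w) => x x'; lra.
    have := side eps (gtr0_norm eps0).
    have := side (- eps); rewrite normrN gtr0_norm// => /(_ erefl).
    by rewrite !a_lin avw; move: (a v y) eps0 => x; nra.
  have := flat (l k z *: w + z).
  rewrite l_lin a_lin lkw avw mulrN1 addNr => /(_ erefl)/eqP.
  by rewrite addrC subr_eq0 => /eqP.
rewrite cardE -(size_map F); apply: uniq_leq_size => [|v /mapP[k _ ->]].
  rewrite map_inj_uniq ?enum_uniq// => k k' Fkk'.
  apply/eqP/negP => /negP kk'; have [w [lkw /(_ k')]] := wit k.
  rewrite eq_sym kk' => /(_ isT).
  by rewrite -(FP k').2 -Fkk' (FP k).2 lkw ltxx.
exact: (FP k).1.
Qed.

(** The facet functionals of [hex_body], normalised so that the facet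
    inequalities read [-1 <= l]. *)
Definition hex_functional (R : realType) k c
    (kappa : hex_index k c * bool + 'I_k * bool) (r : hex_index k c -> R) : R :=
  match kappa with
  | inl (x, b) => (-1) ^+ b * r x
  | inr (y, b) => r (inl (y, b)) - r (inl (y, ~~ b))
  end.

Lemma hex_bodyP (R : realType) k c (r : hex_index k c -> R) :
  hex_body r <-> forall kappa, -1 <= hex_functional kappa r.
Proof.
split=> [rb [[x b]|[y b]]|rk x] /=.
- have [/andP[? ?] _] := rb x; case: b => /=; rewrite ?expr0 ?expr1; lra.
- have [_] := rb (inl (y, ~~ b)); rewrite /= negbK; lra.
split.
  have := rk (inl (x, false)); have := rk (inl (x, true)) => /=.
  by rewrite expr0 expr1; move: (r x) => a; lra.
case: x => [[y b]|y] /=; last by rewrite subrr ler01.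
have := rk (inr (y, ~~ b)); rewrite /= negbK; lra.
Qed.

(** For a coordinate facet [x = -1], up to sign, the point has coordinate
    [-1/2] at the partner of [x], which keeps it away from the difference
    facets; for a difference facet it has the two coordinates [-1/2] and
    [1/2]. *)
Lemma hex_functional_witness (R : realType) k c
    (kappa : hex_index k c * bool + 'I_k * bool) :
  exists r : hex_index k c -> R, hex_functional kappa r = -1 /\
    forall kappa', kappa' != kappa -> -1 < hex_functional kappa' r.
Proof.
case: kappa => [[x b]|[y b]].
- pose r z : R := if z == x then -1 else if z == partner x then - 2^-1 else 0.
  have rx : r x = -1 by rewrite /r eqxx.
  have rn z : z != x -> - 2^-1 <= r z <= 0.
    by move=> zx; rewrite /r (negbTE zx); case: eqP => _; lra.
  exists (fun z => (-1) ^+ b * r z); split; first by rewrite /= rx; case: b; ring.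
  move=> [[z b']|[z b']] zb /=.
    have [zx|/rn] := eqVneq z x.
      rewrite zx rx; have : b' != b by apply: contra zb => /eqP->; rewrite zx.
      by case: b b' {zb} => -[]//= _; lra.
    by case: b' b {zb} => -[] /=; rewrite ?expr0 ?expr1; lra.
  have rp t : r (inl (t, true)) - r (inl (t, false)) \in `]-1, 1[.
    have [tx|tx] := eqVneq (inl (t, true)) x.
      have -> : r (inl (t, false)) = - 2^-1.
        by rewrite /r -tx /= eqxx ifF//; apply/eqP => -[].
      by rewrite tx rx in_itv/=; lra.
    have [fx|fx] := eqVneq (inl (t, false)) x.
      have -> : r (inl (t, true)) = - 2^-1.
        by rewrite /r -fx /= eqxx ifF//; apply/eqP => -[].
      by rewrite fx rx in_itv/=; lra.
    by have := rn _ tx; have := rn _ fx; rewrite in_itv/=; lra.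
  by have := rp z; rewrite in_itv/=; case: b' b {zb} => -[] /=;
    rewrite ?expr0 ?expr1; lra.
- pose r (z : hex_index k c) : R :=
    if z == inl (y, b) then - 2^-1 else if z == inl (y, ~~ b) then 2^-1 else 0.
  have rb z : - 2^-1 <= r z <= 2^-1.
    by rewrite /r; case: eqP => _; [lra|case: eqP => _; lra].
  have byn : inl (y, ~~ b) == inl (y, b) :> hex_index k c = false.
    by apply/eqP => -[]; case: (b).
  exists r; split; first by rewrite /= /r eqxx byn eqxx; lra.
  move=> [[z b']|[z b']] zb /=.
    by have := rb z; case: b' {zb} => /=; rewrite ?expr0 ?expr1; lra.
  have [zy|zy] := eqVneq z y.
    have -> : b' = ~~ b by move: zb; rewrite zy; case: (b) (b') => -[] //; rewrite eqxx.
    by rewrite zy negbK /r byn !eqxx; lra.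
  have r0 t : r (inl (z, t)) = 0.
    by rewrite /r !ifF//; apply/eqP => -[zy']; rewrite zy' eqxx in zy.
  by rewrite !r0; lra.
Qed.

(** The left side counts the facets of the product: two for each coordinate
    and two for each hexagon. *)
Lemma hex_vertex_bound (R : realType) (V : vectType R) (L Q : set 'Hom(V, R^o))
    (vs : seq V) k c (co : 'Hom(V, R^o) -> hex_index k c -> R) :
  hex_coordinates L Q co ->
  (forall f, Q f <-> {in vs, forall v, -1 <= (f v : R)}) ->
  ((k.*2 + c).*2 + k.*2 <= size vs)%N.
Proof.
move=> [co_lin [g coK gK] _ QP] Qvs.
have -> : ((k.*2 + c).*2 + k.*2)%N = #|{: hex_index k c * bool + 'I_k * bool}|.
  by rewrite !(card_sum, card_prod, card_ord, card_bool) !muln2.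
apply: (@facet_functionals_bound R _ _ _ vs
  (fun kappa f => hex_functional kappa (co f)) (fun v f => f v)).
- by move=> [[x b]|[y b]] t f f' /=; rewrite !co_lin; ring.
- by move=> v t f f'; rewrite add_lfunE scale_lfunE.
- by move=> f; rewrite -hex_bodyP -QP Qvs.
- move=> kappa; have [r rP] := @hex_functional_witness R k c kappa.
  by exists (g r); rewrite gK.
Qed.

(** * The model polytopes and the theorem *)

Lemma seq_card (T : choiceType) (A : set T) (vs : seq T) :
  uniq vs -> (forall v, v \in vs <-> A v) -> A #= `I_(size vs).
Proof.
case: vs => [|x0 t] uvs vsA.
  suff -> : A = set0 by rewrite II0; exact: card_eq00.
  by apply/seteqP; split=> x // /vsA.
set vs := x0 :: t in uvs vsA *.
have -> : A = nth x0 vs @` `I_(size vs).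
  apply/seteqP; split=> [v /vsA vin|_ [i /= ilt <-]].
    by exists (index v vs); [move: vin; rewrite -index_mem|exact: nth_index].
  by apply/vsA/mem_nth.
apply: inj_card_eq => i j; rewrite !inE /= => il jl /eqP.
by rewrite nth_uniq// => /eqP.
Qed.

(** A point with coordinates of equal sign lies in one of the two squares. If
    the signs differ, it lies in a triangle with vertices at the origin and
    at one unit vector from each square. *)
Lemma Z2P (R : realType) (x : 'rV[R]_2) :
  Z2 R x <-> [/\ -1 <= x 0 0 <= 1, -1 <= x 0 1 <= 1,
                 x 0 0 - x 0 1 <= 1 & x 0 1 - x 0 0 <= 1].
Proof.
split=> [Zx|[x0 x1 d01 d10]].
  pose S : set 'rV[R]_2 := unit_square R `|` -%R @` unit_square R.
  have SP y : S y -> [/\ -1 <= y 0 0 <= 1, -1 <= y 0 1 <= 1,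
                 y 0 0 - y 0 1 <= 1 & y 0 1 - y 0 0 <= 1].
    case=> [yS|[z zS <-]].
      by have := yS 0; have := yS 1; split; lra.
    by have := zS 0; have := zS 1; rewrite !mxE; split; lra.
  have le (a b c : R) : (forall y, S y -> a * y 0 0 + b * y 0 1 <= c) ->
      a * x 0 0 + b * x 0 1 <= c.
    move=> Sle.
    have [f fE] : exists f : 'Hom('rV[R]_2, R^o),
        forall y, f y = a * y 0 0 + b * y 0 1 :> R.
      by apply: functional_exists => t y z; rewrite !mxE; ring.
    by rewrite -fE; apply: conv_hull_le Zx => y /Sle; rewrite fE.
  have a1 : 1 * x 0 0 + 0 * x 0 1 <= 1 by apply: le => y /SP[]; lra.
  have a2 : -1 * x 0 0 + 0 * x 0 1 <= 1 by apply: le => y /SP[]; lra.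
  have a3 : 0 * x 0 0 + 1 * x 0 1 <= 1 by apply: le => y /SP[]; lra.
  have a4 : 0 * x 0 0 + -1 * x 0 1 <= 1 by apply: le => y /SP[]; lra.
  have a5 : 1 * x 0 0 + -1 * x 0 1 <= 1 by apply: le => y /SP[]; lra.
  have a6 : -1 * x 0 0 + 1 * x 0 1 <= 1 by apply: le => y /SP[]; lra.
  by split; lra.
have ord2 (Pr : 'I_2 -> Prop) : Pr 0 -> Pr 1 -> forall i, Pr i.
  move=> P0 P1 [[|[|//]] ilt]; first by rewrite (_ : Ordinal _ = 0)//; apply/val_inj.
  by rewrite (_ : Ordinal _ = 1)//; apply/val_inj.
pose pt (a b : R) : 'rV[R]_2 := \row_i (if i == 0 then a else b).
have triangle (a b : R) (p q : 'rV[R]_2) : 0 <= a -> 0 <= b -> a + b <= 1 ->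
    (unit_square R `|` -%R @` unit_square R) p ->
    (unit_square R `|` -%R @` unit_square R) q ->
    x = a *: p + b *: q -> Z2 R x.
  move=> a0 b0 ab Sp Sq ->.
  exists 3%N, (fun i => if i == 0 then p else if i == 1 then q else 0),
    (fun i => if i == 0 then a else if i == 1 then b else 1 - a - b).
  split.
  - move=> i; case: eqP => // _; case: eqP => // _.
    by left=> j; rewrite mxE lexx ler01.
  - by move=> i; case: eqP => // _; case: eqP => // _; lra.
  - by rewrite !big_ord_recl big_ord0 /=; ring.
  - by rewrite !big_ord_recl big_ord0 /= scaler0 !addr0.
have [p0|n0] := leP 0 (x 0 0); have [p1|n1] := leP 0 (x 0 1).
- by apply: conv_hull_sub; left; apply: ord2; lra.
- apply: (@triangle (x 0 0) (- x 0 1) (pt 1 0) (pt 0 (-1))) => //; [lra| | |].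
  + by left; apply: ord2; rewrite mxE/=; lra.
  + by right; exists (pt 0 1); [apply: ord2; rewrite mxE/=; lra|
      apply/rowP; apply: ord2; rewrite !mxE/=; lra].
  + by apply/rowP; apply: ord2; rewrite !mxE/=; ring.
- apply: (@triangle (- x 0 0) (x 0 1) (pt (-1) 0) (pt 0 1)) => //; [lra|lra| | |].
  + by right; exists (pt 1 0); [apply: ord2; rewrite mxE/=; lra|
      apply/rowP; apply: ord2; rewrite !mxE/=; lra].
  + by left; apply: ord2; rewrite mxE/=; lra.
  + by apply/rowP; apply: ord2; rewrite !mxE/=; ring.
- apply: conv_hull_sub; right; exists (- x); last by rewrite opprK.
  by apply: ord2; rewrite mxE; lra.
Qed.

Lemma even_hex_coordinates (R : realType) k :
  exists co : {ffun 'I_k -> 'rV[R]_2} -> hex_index k 0 -> R,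
    hex_coordinates (set_power k (int_lattice2 R)) (set_power k (Z2 R)) co.
Proof.
pose co (w : {ffun 'I_k -> 'rV[R]_2}) (x : hex_index k 0) : R :=
  match x with inl (y, b) => w y 0 (if b then 1 else 0) | inr _ => 0 end.
exists co; split.
- move=> a w w' [[y b]|[]//]; by rewrite /= !ffunE !mxE.
- exists (fun r => [ffun y => \row_i r (inl (y, i == 1))]) => [w|r].
    apply/ffunP => y; apply/rowP => i; rewrite ffunE mxE /=.
    by case: i => -[|[|//]] ? /=; congr (w y 0 _); apply/val_inj.
  by apply/funext => -[[y []]|[]//]; rewrite /= ffunE mxE.
- move=> w; split=> [wint [[y b]|[]//]|wint y i]; first exact: wint.
  by have := wint (inl (y, i == 1)); case: i => -[|[|//]] ? /=;
    congr (w y 0 _ \is a _); apply/val_inj.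
- move=> w; split=> [wZ [[y b]|[]//]|wb y].
    by have /Z2P[] := wZ y; case: b => /=; lra.
  apply/Z2P; have /= := wb (inl (y, true)); have /= := wb (inl (y, false)).
  by move=> [? ?] [? ?]; split.
Qed.

Lemma odd_hex_coordinates (R : realType) k :
  exists co : R^o * {ffun 'I_k -> 'rV[R]_2} -> hex_index k 1 -> R,
    hex_coordinates (int_lattice1 R `*` set_power k (int_lattice2 R))
      (segment1 R `*` set_power k (Z2 R)) co.
Proof.
have [co [co_lin [g coK gK] LP QP]] := even_hex_coordinates R k.
pose co1 (w : R^o * {ffun 'I_k -> 'rV[R]_2}) (x : hex_index k 1) : R :=
  match x with inl y => co w.2 (inl y) | inr _ => w.1 end.
exists co1; split.
- by move=> a [t w] [t' w'] [y|y] /=; rewrite ?co_lin.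
- exists (fun r => (r (inr ord0), g (fun x : hex_index k 0 =>
      match x with inl y => r (inl y) | inr _ => 0 end))) => [[t w]|r].
    rewrite /=; congr (_, _); apply: (can_inj coK); rewrite gK.
    by apply/funext => -[y|[]].
  apply/funext => -[y|y] /=; first by rewrite gK.
  by rewrite (ord1 y).
- move=> [t w]; split=> [[/= tint /LP wint] [y|_]//|wint]; first exact: (wint (inl y)).
  by split; [exact: (wint (inr ord0))|apply/LP => -[y|[]//]; exact: (wint (inl y))].
- move=> [t w]; split=> [[/= tb /QP wb] [[y b]|y] /=|wb].
  + exact: (wb (inl (y, b))).
  + by rewrite subrr ler01; split.
  + split; first by have [] := wb (inr ord0).
    by apply/QP => -[[y b]|[]//]; exact: (wb (inl (y, b))).
Qed.

Lemma vertex_count (R : realType) (V : vectType R) (M P : set V) (d : nat) :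
  (0 < d)%N -> \dim {:V} = d -> is_reflexive M P -> is_simplicial P ->
  centrally_symmetric P ->
  exists vs : seq V, [/\ uniq vs, forall v, v \in vs <-> vertices P v,
    (size vs + odd d <= 3 * d)%N &
    (size vs + odd d = 3 * d)%N <->
    exists co : 'Hom(V, R^o) -> hex_index d./2 (odd d) -> R,
      hex_coordinates (dual_lattice M) (dual_polytope P) co].
Proof.
move=> d_gt0 dimV [[[s PE] latP] dimP _ [[t DE] latD]] simpP symP.
rewrite dimV in dimP.
pose vs := [seq v <- undup s | `[< vertices P v >]].
have uniq_vs : uniq vs by rewrite filter_uniq ?undup_uniq.
have vsP v : v \in vs <-> vertices P v.
  rewrite mem_filter mem_undup; split=> [/andP[/asboolP//]|vv].
  rewrite asboolT//=; apply: (vertex_in_generators (S := [set` s]) vv).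
    by move=> p; exact: generator_mem.
  by have := vertex_in vv; rewrite {1}PE.
have t0 : t != [::].
  apply/eqP => t0; have : dual_polytope P 0.
    by move=> x _; rewrite zero_lfunE oppr_le0 ler01.
  rewrite DE t0 => -[[|n] [p [c [tp _ c1 _]]]]; last by have := tp ord0.
  by move/eqP: c1; rewrite big_ord0 sign_eqE.
(* Maximising the zero functional yields an arbitrary vertex. *)
have [u uv _] := vertex_maximizing 0 t0.
rewrite -DE in uv.
have [e be FE] := dual_vertex_basis PE dimV d_gt0 dimP simpP uv.
have [bound _] := equator_bound PE dimV d_gt0 dimP simpP symP latP latD uv be FE
  uniq_vs vsP.
have size_vs := size_vertices PE dimV d_gt0 symP latP latD uv be FE
  uniq_vs vsP.
exists vs; split=> //; first by rewrite size_vs; lia.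
split=> [eq_d|[co hexco]].
  apply: (equality_hex_coordinates PE dimV d_gt0 dimP simpP symP latP latD uv be FE
    uniq_vs vsP).
  by rewrite eq_d.
have := hex_vertex_bound hexco (dual_polytope_vertices PE vsP).
have := odd_double_half d; move: bound; rewrite size_vs; lia.
Qed.

Theorem theorem5p9 (R : realType) (d : nat) (V : vectType R) (M P : set V)
    (d_gt0 : (0 < d)%N) (dimV : \dim {:V} = d) (latM : is_lattice M)
    (reflP : is_reflexive M P) (simpP : is_simplicial P)
    (symP : centrally_symmetric P) :
  (~~ odd d ->
     (vertices P #<= `I_(3 * d)) /\
     ((vertices P #= `I_(3 * d)) <->
      lattice_iso (dual_lattice M) (dual_polytope P)
        (set_power d./2 (int_lattice2 R)) (set_power d./2 (Z2 R)))) /\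
  (odd d ->
     (vertices P #<= `I_(3 * d - 1)) /\
     ((vertices P #= `I_(3 * d - 1)) <->
      lattice_iso (dual_lattice M) (dual_polytope P)
        (int_lattice1 R `*` set_power d.-1./2 (int_lattice2 R))
        (segment1 R `*` set_power d.-1./2 (Z2 R)))).
Proof.
have [vs [uniq_vs vsP bound hexP]] := vertex_count d_gt0 dimV reflP simpP symP.
have cardP := seq_card uniq_vs vsP.
have le_card n : (vertices P #<= `I_n) = (size vs <= n)%N.
  by rewrite (card_le_eql cardP) card_le_II.
have eq_card n : (vertices P #= `I_n) <-> size vs = n.
  by rewrite (card_eql cardP); split=> [/card_eq_II|/card_eq_II].
split=> d_odd; rewrite le_card eq_card.
  rewrite (negbTE d_odd) addn0 in bound hexP; split=> //; rewrite hexP.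
  have [co0 hex0] := even_hex_coordinates R d./2.
  split=> [[co hexco]|iso]; first exact: hex_coordinates_iso hexco hex0.
  exact: hex_coordinates_pullback iso hex0.
rewrite d_odd in bound hexP.
have -> : d.-1./2 = d./2 by rewrite -[in LHS](odd_double_half d) d_odd /= doubleK.
have eq_size : size vs = (3 * d - 1)%N <-> (size vs + true)%N = (3 * d)%N.
  by split; lia.
split; first by move: bound; lia.
rewrite eq_size hexP; have [co1 hex1] := odd_hex_coordinates R d./2.
split=> [[co hexco]|iso]; first exact: hex_coordinates_iso hexco hex1.
exact: hex_coordinates_pullback iso hex1.
Qed.
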